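(* Let $d\geq3$ and let $G^*$ be a $d$-regular plane graph with root-vertex $v^*$. For a regular labelling $L^*$ of $G^*$, let $\xi(L^* )=(T_1^*,\dots,T_d^* )$, where $T_i^*$ is the oriented subgraph formed by all arcs $(u,e)$ with $u\neq v^*$ such that the corner preceding $e$ in clockwise order around $u$ has color $i$. Then $\xi$ is a bijection from the set of regular labellings of $G^*$ to the set of regular decompositions of $G^*$. Consequently, if the dual $d$-angulation $G$ has $d$ distinct external vertices $u_1,\dots,u_d$, then the map $\chi$ sending a Schnyder decomposition $(F_1,\dots,F_d)$ of $G$ to $(T_1^*,\dots,T_d^* )$, where $T_i^*$ is the set of edges of $G^*$ dual to the edges of $G$ not belonging to $T_i:=F_i\cup\{\text{external edges of }G\text{ other than }\{u_i,u_{i+1}\}\}$, each oriented toward $v^*$, is a bijection from the set of Schnyder decompositions of $G$ to the set of regular decompositions of $G^*$.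
   Context: Graphs are finite, loopless, possibly with multiple edges. A plane graph is a connected planar graph with a fixed crossing-free drawing; the unbounded face is external, vertices/edges on it are external, others internal. A corner is a pair of consecutive edges around a vertex. $[d]=\{1,\dots,d\}$ with arithmetic mod $d$. In $G^*$, root-edges $e_1^*,\dots,e_d^*$ are the edges at $v^*$ in counterclockwise order, root-faces $f_1^*,\dots,f_d^*$ the faces at $v^*$ in counterclockwise order with $e_i^*$ between $f_i^*$ and $f_{i+1}^*$; other vertices and faces are non-root. A regular labelling of $G^*$ colors each corner by $[d]$ so that: (i) colors $1,\dots,d$ appear in clockwise order around each non-root vertex and in counterclockwise order around $v^*$; (ii) all corners incident to $f_i^*$ have color $i$; (iii) in clockwise order around each non-root face exactly one corner has larger color (as an integer) than the next one. A regular decomposition of $G^*$ is a covering of the edges of $G^*$ by $d$ spanning trees $T_1^*,\dots,T_d^*$ of $G^*$, each oriented toward $v^*$, such that: (i) each edge not incident to $v^*$ belongs to exactly two of the trees, with opposite orientations in them; (ii) the root-edge $e_i^*$ belongs only to $T_i^*$; (iii) around each non-root vertex $v$, the edges leading $v$ to its parent in $T_1^*,\dots,T_d^*$ appear in clockwise order. The dual $G$ has a vertex in each face of $G^*$ and an edge crossing each edge of $G^*$, drawn so that its external face is the face containing $v^*$; it is a $d$-angulation (every face of degree $d$), and its vertex $u_i$ is the one corresponding to $f_i^*$, so that $\{u_i,u_{i+1}\}$ is dual to $e_i^*$. A Schnyder decomposition of $G$ is a covering of the internal edges of $G$ by oriented forests $F_1,\dots,F_d$ such that: (i) each internal edge is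 in exactly $d-2$ forests; (ii) $F_i$ spans all vertices except $u_i,u_{i+1}$ and consists of $d-2$ trees, each containing one $u_j$, $j\neq i,i+1$, and oriented toward it; (iii) around each internal vertex $v$ the outgoing arcs of colors $1,\dots,d$ appear in clockwise order, and with $e_i$ the edge carrying the outgoing arc of color $i$, incoming arcs of color $i$ lie strictly between $e_{i+1}$ and $e_{i-1}$ in clockwise order around $v$. *)

(* Defs.v *)
Set Warnings "-notation-overridden".
From mathcomp Require Import all_boot all_fingroup.

Set Implicit Arguments.
Unset Strict Implicit.
Unset Printing Implicit Defensive.

(** Plane graphs are encoded as combinatorial maps.  A dart is an arc (u, e):
    an edge together with one of its ends, the origin.  [opp] gives the
    opposite arc of the same edge and [cw h] is the next dart after [h] in
    clockwise order around its origin.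

    Corners are indexed by darts: corner [h] is the corner preceding [h] in
    clockwise order around its origin, i.e. the one between [cw^-1 h] and [h].
    It lies on the left of [h]. *)
Record cmap := CMap {
  dart : finType;
  opp : {perm dart};
  cw : {perm dart};
  oppK : involutive opp;
  opp_neq : forall h, opp h != h
}.

Section Maps.
Variable M : cmap.
Implicit Types (h : dart M) (A S R : {set {set dart M}}) (E : {set dart M}).

(** A vertex is the set of darts originating at it. *)
Definition vert h : {set dart M} := porbit (cw M) h.
Definition vertices : {set {set dart M}} := porbits (cw M).

Definition edge h : {set dart M} := [set h; opp M h].

(** [fcw h] is the corner that follows corner [h] in clockwise order around
    their face: [(cw^-1 * opp) h = opp (cw^-1 h)], and walking along [cw^-1 h]
    from corner [h] keeps the face on the right.  "Clockwise around a face"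
    is as seen from inside the face. *)
Definition fcw : {perm dart M} := ((cw M)^-1 * opp M)%g.

(** A face is the set of its corners. *)
Definition face h : {set dart M} := porbit fcw h.
Definition faces : {set {set dart M}} := porbits fcw.

(** [adj E x y]: some arc of [E] goes from vertex [x] to vertex [y]. *)
Definition adj E : rel {set dart M} :=
  [rel x y | [exists h in E, (vert h == x) && (vert (opp M h) == y)]].

(** Existence of a path following the arcs of [E]. *)
Definition linked E : rel {set dart M} := connect (adj E).

(** All arcs of the undirected graph underlying [E]. *)
Definition und E : {set dart M} := E :|: [set opp M h | h in E].

Definition loopless : Prop := forall h, vert (opp M h) != vert h.
Definition connected : Prop :=
  {in vertices &, forall x y, linked [set: dart M] x y}.

(** For a connected map, Euler's relation holds iff the genus is 0. *)
Definition planar : Prop :=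
  #|vertices| + #|faces| = #|porbits (opp M)| + 2.

Definition plane_graph : Prop := [/\ loopless, connected & planar].

Definition regular (d : nat) : Prop := forall h, #|vert h| = d.

(** No cycle: no nonempty cyclic sequence of consecutive arcs with pairwise
    distinct vertices and pairwise distinct edges. *)
Definition acyclic E : Prop :=
  forall c : seq (dart M), {subset c <= E} ->
    path.cycle [rel h k | vert (opp M h) == vert k] c ->
    uniq (map vert c) -> uniq (map edge c) -> c = [::].

(** The arcs in [E] form an oriented forest with vertex set [S] (isolated
    vertices allowed), each of whose trees contains exactly one vertex of [R]
    and is oriented toward it. *)
Definition rooted_forest E (S R : {set {set dart M}}) : Prop :=
  [/\ forall h, h \in E -> opp M h \notin E,
      forall h, h \in E -> vert h \in S /\ vert (opp M h) \in S,
      acyclic (und E),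
      forall x, x \in S -> #|[set y in R | linked (und E) x y]| = 1
    & forall x y, x \in S -> y \in R -> linked (und E) x y -> linked E x y].

Definition spanning_tree E (x : {set dart M}) : Prop :=
  rooted_forest E vertices [set x].

(** Orientation of a (symmetric) spanning tree [E] toward the vertex [x]: an
    arc is kept iff [x] can be reached from its head without using its edge. *)
Definition orient_toward (x : {set dart M}) E : {set dart M} :=
  [set h in E | linked (E :\: edge h) (vert (opp M h)) x].

(** The darts [p 1, ..., p d] of the vertex [x], possibly with repetitions,
    appear in clockwise order: turning clockwise from [p 1] to [p 2], ..., to
    [p d], and back to [p 1], one makes exactly one turn around [x]. *)
Definition clockwise (d : nat) (x : {set dart M}) (p : 'I_d -> dart M) : Prop :=
  (forall i, vert (p i) = x) /\
  \sum_(i < d) findex (cw M) (p i) (p (ordS i)) = #|x|.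

(** [h] is met strictly after [a] and strictly before [b] when turning
    clockwise from [a]; if [a = b], one makes a full turn before meeting [b]. *)
Definition strictly_cw_between (a h b : dart M) : bool :=
  0 < findex (cw M) a h
    < (if a == b then #|vert a| else findex (cw M) a b).

End Maps.

(** The colors [1, ..., d] are represented by ['I_d] (shifted by one), with
    [ordS] and [ord_pred] the cyclic successor and predecessor. *)

Section Regular.
Variables (d : nat) (M : cmap) (r : dart M).
Implicit Types (i : 'I_d) (h : dart M).

(** The root-vertex is the origin of [r] and [r] is the first root-edge; the
    root-edges are taken in counterclockwise order. *)
Definition root_vertex : {set dart M} := vert r.
Definition root_edge i : dart M := iter i (cw M)^-1%g r.

(** The root-face preceding [root_edge i] in counterclockwise order, hence the
    one containing the corner that follows [root_edge i] in clockwise order. *)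
Definition root_face i : {set dart M} := face (cw M (root_edge i)).

(** In a [d]-regular map, a vertex has exactly [d] corners, so the colors
    [1, ..., d] appear in clockwise order iff the color increases by one (mod
    [d]) at each clockwise step. *)
Definition regular_labelling (L : {ffun dart M -> 'I_d}) : Prop :=
  [/\ forall h, vert h != root_vertex -> L (cw M h) = ordS (L h),
      forall h, vert h = root_vertex -> L (cw M h) = ord_pred (L h),
      forall i h, h \in root_face i -> L h = i
    & forall f, f \in faces M -> (forall i, f != root_face i) ->
        #|[set h in f | L (fcw M h) < L h]| = 1].

Definition regular_decomposition (T : {ffun 'I_d -> {set dart M}}) : Prop :=
  [/\ forall h, exists i, h \in und (T i),
      forall i, spanning_tree (T i) root_vertex,
      forall h, vert h != root_vertex -> vert (opp M h) != root_vertex ->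
        exists i j, [/\ i != j, h \in T i, opp M h \in T j
          & [set k | h \in und (T k)] = [set i; j]],
      forall i j, (root_edge i \in und (T j)) = (j == i)
    & forall x, x \in vertices M -> x != root_vertex ->
        exists2 p : 'I_d -> dart M,
          forall i, [set h in T i | vert h == x] = [set p i]
          & clockwise x p].

Definition xi (L : {ffun dart M -> 'I_d}) : {ffun 'I_d -> {set dart M}} :=
  [ffun i => [set h | (vert h != root_vertex) && (L h == i)]].

End Regular.

(** Schnyder decompositions of a plane graph [G] whose external face is the
    one on the left of the dart [s]. *)
Section Schnyder.
Variables (d : nat) (G : cmap) (s : dart G).
Implicit Types (i j : 'I_d) (h : dart G).

(** The arc from u_i to u_{i+1}: starting with [s], one follows the boundary
    of the external face keeping it on the left. *)
Definition ext_dart i : dart G := iter i (fcw G)^-1%g s.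
Definition ext_vertex i : {set dart G} := vert (ext_dart i).

Definition external h : bool := (h \in face s) || (opp G h \in face s).

Definition schnyder_decomposition (F : {ffun 'I_d -> {set dart G}}) : Prop :=
  [/\ forall h, (exists i, h \in und (F i)) <-> ~~ external h,
      forall h, ~~ external h -> #|[set i | h \in und (F i)]| = d - 2,
      forall i, rooted_forest (F i)
        (vertices G :\: [set ext_vertex i; ext_vertex (ordS i)])
        [set ext_vertex j | j : 'I_d & (j != i) && (j != ordS i)]
    & forall x, x \in vertices G -> (forall j, x != ext_vertex j) ->
        exists p : 'I_d -> dart G,
          [/\ forall i, [set h in F i | vert h == x] = [set p i],
              clockwise x p
            & forall i h, h \in F i -> vert (opp G h) = x ->
                strictly_cw_between (p (ordS i)) (opp G h) (p (ord_pred i))]].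

(** All arcs of T_i, forgetting orientations. *)
Definition completed_forest (F : {ffun 'I_d -> {set dart G}}) i : {set dart G} :=
  und (F i) :|: [set h | external h && (h \notin edge (ext_dart i))].

End Schnyder.

(** The dual map has the same darts: the dual of the edge of [h] is the edge of
    [h], and as a dart of the dual, [h] goes from the face on the left of [h]
    to the face on its right. *)
Definition dual (M : cmap) : cmap := CMap (fcw M) (@oppK M) (@opp_neq M).

(** In the dual, the first root-edge is crossed from the first root-face to the
    second one by [opp r], which leaves the root-vertex on its left. *)
Definition dual_root (M : cmap) (r : dart M) : dart (dual M) := opp M r.

Definition chi (d : nat) (M : cmap) (r : dart M)
    (F : {ffun 'I_d -> {set dart (dual M)}}) : {ffun 'I_d -> {set dart M}} :=
  [ffun i => orient_toward (root_vertex r)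
               (~: completed_forest (dual_root r) F i)].

Lemma ext_dart_dual d (M : cmap) (r : dart M) (i : 'I_d) :
  ext_dart (dual_root r) i = opp M (root_edge r i).
Proof.
rewrite /ext_dart /root_edge /dual_root; elim: (nat_of_ord i) => //= n ->.
apply: (canLR (permK _)); rewrite /fcw !permM /=.
set h := iter n _ r; have -> : (fcw M)^-1%g (opp M ((cw M)^-1%g h)) = h.
  by apply: (canLR (permK _)); rewrite /fcw permM.
by [].
Qed.

(** The vertex u_i of the dual corresponds to the i-th root-face. *)
Lemma ext_vertex_dual d (M : cmap) (r : dart M) (i : 'I_d) :
  ext_vertex (dual_root r) i = root_face r i.
Proof.
rewrite /ext_vertex ext_dart_dual /vert /root_face /face /=.
apply/eqP; rewrite eq_porbit_mem porbit_sym.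
have -> : opp M (root_edge r i) = fcw M (cw M (root_edge r i)).
  by rewrite /fcw permM permK.
by rewrite porbit_sym (mem_porbit (fcw M) 1).
Qed.

(* Main.v *)
From mathcomp Require Import all_boot all_fingroup all_algebra zify.
Require Import Defs.
From mathcomp Require Import functions.

Set Implicit Arguments.
Unset Strict Implicit.
Unset Printing Implicit Defensive.

(** Say that a step between consecutive corners of a face crosses [j] when the
    colors go from [j] to [j+1] during the step.  For an edge away from the
    root, the color increments of its two sides add up to [d - 2], unless both
    of its arcs have the same color, and Euler's relation turns this into the
    count that makes "two trees per edge" equivalent to "one turn of the colors
    around each non-root face".

    For a regular labelling [L], let [psi L j] be the set of the arcs of the dual
    which cross [j].  Each non-root vertex has one outgoing arc in [T_j], each
    non-root face has one outgoing arc in [psi L j], and the edges of these arcs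
    are distinct.  If the set [U] of the vertices from which [T_j] leads to the
    root were proper, there would be fewer edges avoiding [U] than vertices and
    faces avoiding [U]: this follows from Euler's relation and from the ranks
    over F_2 of the incidence matrices of [U].  Hence [T_j] is a spanning tree,
    and the same argument in the dual shows that [psi L j] is a forest rooted at
    the root-faces.  Conversely, around a monochromatic non-root face [T_j] would
    contain a directed cycle, so that [xi] is onto.

    Finally [chi (psi L) = xi L], and every Schnyder decomposition is [psi L] for
    a regular labelling [L], which is read off the positions of the outgoing arcs
    around each face. *)

(** * Orbits of permutations *)

Section Orbits.
Variables (T : finType) (s : {perm T}).
Implicit Types x y : T.

Lemma mem_porbit_fconnect x y : (y \in porbit s x) = fconnect s x y.
Proof.
apply/porbitP/idP => [[i ->]|]; first by rewrite permX fconnect_iter.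
by move=> sxy; exists (findex s x y); rewrite permX iter_findex.
Qed.

Lemma order_porbit x : fingraph.order s x = #|porbit s x|.
Proof. by apply: eq_card => y; rewrite mem_porbit_fconnect. Qed.

Lemma porbit_step x : porbit s (s x) = porbit s x.
Proof. by rewrite -[s x]/((s ^+ 1)%g x) porbit_perm. Qed.

Lemma porbit_stepV x : porbit s ((s^-1)%g x) = porbit s x.
Proof. by rewrite -(porbit_step ((s^-1)%g x)) permKV. Qed.

Lemma mem_porbit_iter m x : iter m s x \in porbit s x.
Proof. by rewrite -permX mem_porbit. Qed.

Lemma porbit_iter m x : porbit s (iter m s x) = porbit s x.
Proof. by rewrite -permX porbit_perm. Qed.

Lemma eq_porbitP x y : reflect (porbit s x = porbit s y) (x \in porbit s y).
Proof. by rewrite -eq_porbit_mem; apply: eqP. Qed.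

Lemma porbit_mem x : porbit s x \in porbits s.
Proof. exact: imset_f. Qed.

Lemma porbitsP (f : {set T}) : f \in porbits s -> exists x, f = porbit s x.
Proof. by case/imsetP => x _ ->; exists x. Qed.

Lemma porbits_mem (f : {set T}) x : f \in porbits s -> (x \in f) = (porbit s x == f).
Proof. by case/porbitsP => y ->; rewrite eq_porbit_mem. Qed.

Lemma porbit_iterP x y :
  y \in porbit s x -> exists2 m, m < #|porbit s x| & y = iter m s x.
Proof.
rewrite mem_porbit_fconnect => sxy; exists (findex s x y).
  by rewrite -order_porbit findex_max.
by rewrite iter_findex.
Qed.

Lemma porbit_const (A : Type) (F : T -> A) x y :
  (forall z, z \in porbit s x -> F (s z) = F z) -> y \in porbit s x -> F y = F x.
Proof.
move=> Fs /porbit_iterP[m _ ->]; elim: m => //= m <-.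
by rewrite Fs // mem_porbit_iter.
Qed.

Lemma sum_porbits (F : T -> nat) :
  \sum_(f in porbits s) \sum_(x in f) F x = \sum_x F x.
Proof.
rewrite (partition_big (porbit s) (mem (porbits s))) /=; last first.
  by move=> x _; apply: porbit_mem.
apply: eq_bigr => f fs; apply: eq_bigl => x.
by rewrite porbits_mem.
Qed.

Lemma sum_porbit_step (F : T -> nat) x :
  \sum_(y in porbit s x) F (s y) = \sum_(y in porbit s x) F y.
Proof.
rewrite [RHS](reindex_inj (@perm_inj _ s)) /=; apply: eq_bigl => y.
by rewrite -!eq_porbit_mem porbit_step.
Qed.

Lemma sum_perm (F : T -> nat) : \sum_x F (s x) = \sum_x F x.
Proof. by rewrite [RHS](reindex_inj (@perm_inj _ s)). Qed.

Lemma findexK x y : y \in porbit s x -> iter (findex s x y) s x = y.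
Proof. by rewrite mem_porbit_fconnect => /iter_findex. Qed.

Lemma findex_lt x y : y \in porbit s x -> findex s x y < #|porbit s x|.
Proof. by rewrite mem_porbit_fconnect -order_porbit; apply: findex_max. Qed.

Lemma findex_iter_lt m x : m < #|porbit s x| -> findex s x (iter m s x) = m.
Proof. by rewrite -order_porbit; apply: findex_iter. Qed.

Lemma iter_neq m x y :
  y \in porbit s x -> m < findex s x y -> iter m s x != y.
Proof.
move=> xy lt_m; apply/eqP => def_y.
have := findex_iter_lt (ltn_trans lt_m (findex_lt xy)).
by rewrite def_y => eq_m; rewrite eq_m ltnn in lt_m.
Qed.

Lemma iter_neq0 m x : 0 < m < #|porbit s x| -> iter m s x != x.
Proof.
case/andP=> m_gt0 lt_m; apply/eqP => def_x.
by have := findex_iter_lt lt_m; rewrite def_x findex0 => m0; rewrite -m0 in m_gt0.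
Qed.

End Orbits.

(** * Cyclic intervals of colors *)

Section Colors.
Variable d : nat.
Implicit Types a b i j : 'I_d.

Lemma val_ordS i : ordS i = (if i.+1 == d then 0 else i.+1) :> nat.
Proof.
rewrite /=; case: eqP => [->|/eqP ne]; first by rewrite modnn.
by rewrite modn_small // ltn_neqAle ne ltn_ord.
Qed.

Lemma val_ord_pred i : ord_pred i = (if i == 0 :> nat then d.-1 else i.-1) :> nat.
Proof.
have := ltn_ord i; rewrite /=; case: (nat_of_ord i) => [|n] /= lt_n.
  by rewrite modn_small // prednK.
by rewrite -?addSn /= modnDr modn_small // ltnW.
Qed.

(** The representative of [b - a] modulo [d] among [0, ..., d-1], written with a test so that it
    stays within linear arithmetic. *)
Definition cdist a b : nat := if a <= b then b - a else b + d - a.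

(** Going up cyclically from [a] to [b], one steps from [j] to [j+1]; nothing is
    crossed when [a = b]. *)
Definition crossed j a b : bool := cdist a j < cdist a b.

Lemma ordS_cases i :
  (i.+1 = d /\ ordS i = 0 :> nat) \/ (i.+1 < d /\ ordS i = i.+1 :> nat).
Proof.
rewrite val_ordS; have := ltn_ord i; case: eqP => [->|/eqP ne]; first by left.
by rewrite leq_eqVlt (negPf ne) /= => lt_i; right.
Qed.

Lemma ord_pred_cases i :
  (i = 0 :> nat /\ (ord_pred i).+1 = d) \/ (0 < i /\ i = (ord_pred i).+1 :> nat).
Proof.
have := ltn_ord i; rewrite val_ord_pred; case: eqP => [-> d_gt0|/eqP i0 _].
  by left; rewrite prednK.
by right; rewrite lt0n i0 prednK // lt0n.
Qed.

Lemma cdist_cases a b :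
  (a <= b /\ cdist a b = b - a) \/ (b < a /\ cdist a b = b + d - a).
Proof. by rewrite /cdist; case: leqP; [left|right]. Qed.

End Colors.

Ltac cyclic_lia :=
  rewrite /crossed;
  repeat match goal with |- context [cdist ?a ?b] =>
    have := cdist_cases a b; move: (cdist a b) => ? end;
  repeat match goal with |- context [nat_of_ord (ordS ?i)] =>
    have := ordS_cases i; move: (nat_of_ord (ordS i)) => ? end;
  repeat match goal with |- context [nat_of_ord (ord_pred ?i)] =>
    have := ord_pred_cases i; move: (nat_of_ord (ord_pred i)) => ? end;
  repeat match goal with |- context [nat_of_ord ?i] =>
    have := ltn_ord i; move: (nat_of_ord i) => ? end;
  lia.

Section ColorArithmetic.
Variable d : nat.
Implicit Types a b c i j s t : 'I_d.

Lemma cdist_lt a b : cdist a b < d.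
Proof. by cyclic_lia. Qed.

Lemma cdist_eq0 a b : (cdist a b == 0) = (a == b).
Proof.
apply/eqP/eqP => [|->]; last by rewrite /cdist leqnn subnn.
by move=> ab0; apply: val_inj => /=; move: ab0; cyclic_lia.
Qed.

Lemma cdistaa a : cdist a a = 0.
Proof. by apply/eqP; rewrite cdist_eq0. Qed.

Lemma cdistK a b1 b2 : cdist a b1 = cdist a b2 -> b1 = b2.
Proof.
move=> eq_ab; apply: val_inj; by move: eq_ab => /=; cyclic_lia.
Qed.

Lemma crossedaa j a : crossed j a a = false.
Proof. by rewrite /crossed cdistaa. Qed.

Lemma card_crossed a b : #|[set j | crossed j a b]| = cdist a b.
Proof.
pose g j := Ordinal (cdist_lt a j).
have g_inj : injective g by move=> j1 j2 /(congr1 val) /cdistK.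
have -> : [set j | crossed j a b] = g @^-1: [set k : 'I_d | k < cdist a b].
  by apply/setP=> j; rewrite !inE.
rewrite on_card_preimset; last by apply: onW_bij; apply: injF_bij.
rewrite cardsE -sum1_card.
rewrite -(big_ord_widen_cond _ predT (fun=> 1) (ltnW (cdist_lt a b))).
by rewrite sum1_card card_ord.
Qed.

(** Counted from [j+1], a color grows at each step up, except for the step from [j] to [j+1], where
    it drops from [d-1] to 0. *)
Lemma crossed_wrap j a b :
  crossed j a b = (cdist (ordS j) b < cdist (ordS j) a).
Proof.
apply/idP/idP; cyclic_lia.
Qed.

(** The crossed colors are [b+1, ..., a-1] cyclically: those other than [a] and [b] from which going
    up meets [a] before [b]. *)
Lemma crossed_ordS j a b :
  a != b -> crossed j (ordS b) a = (0 < cdist j a < cdist j b).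
Proof.
by move=> ab; apply/idP/idP; move: ab; rewrite -val_eqE /=; cyclic_lia.
Qed.

(** An increment is the difference of two integer values, plus [d] at a descent; the differences
    cancel around the orbit. *)
Lemma sum_cdist (T : finType) (s : {perm T}) (F : T -> 'I_d) x :
  \sum_(y in porbit s x) cdist (F y) (F (s y))
    = d * #|[set y in porbit s x | F (s y) < F y]|.
Proof.
have -> : d * #|[set y in porbit s x | F (s y) < F y]|
    = \sum_(y in porbit s x) (if F (s y) < F y then d else 0).
  by rewrite -big_mkcondr sum_nat_const mulnC; congr (_ * _); apply: eq_card => y;
     rewrite !inE.
have : \sum_(y in porbit s x) (cdist (F y) (F (s y)) + F y)
     = \sum_(y in porbit s x) (F (s y) + if F (s y) < F y then d else 0).
  apply: eq_bigr => y _; case: ifP; cyclic_lia.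
rewrite !big_split /= (sum_porbit_step s (fun y => nat_of_ord (F y))); lia.
Qed.

Definition cshift a b : 'I_d := Ordinal (cdist_lt a b).

Lemma cdist_cshift c a b : cdist (cshift c a) (cshift c b) = cdist a b.
Proof.
have := cdist_cases (cshift c a) (cshift c b); move: (cdist (cshift _ _) _) => ? /=.
by cyclic_lia.
Qed.

(* Both sides count the turns made by the colors around the orbit, the left one
   through the threshold between [j] and [j+1]. *)
Lemma card_orbit_crossed (T : finType) (s : {perm T}) (F : T -> 'I_d) x j :
  #|[set y in porbit s x | crossed j (F ((s^-1)%g y)) (F y)]|
    = #|[set y in porbit s x | F (s y) < F y]|.
Proof.
have d_gt0 : 0 < d by apply: leq_ltn_trans (ltn_ord j).
apply/eqP; rewrite -(eqn_pmul2l d_gt0) -sum_cdist.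
(* Rotating the colors so that [j+1] becomes 0 keeps the increments and turns the crossings of [j]
   into descents. *)
under [X in _ == X]eq_bigr do rewrite -(cdist_cshift (ordS j)).
rewrite (sum_cdist _ (fun y => cshift (ordS j) (F y))) eqn_pmul2l //; apply/eqP.
rewrite -[RHS](card_imset _ (@perm_inj _ s)); apply: eq_card => y.
rewrite !inE; apply/idP/imsetP => [/andP[xy cr]|[z]].
  exists ((s^-1)%g y); last by rewrite permKV.
  by rewrite inE permKV -eq_porbit_mem porbit_stepV eq_porbit_mem xy -crossed_wrap.
rewrite inE => /andP[xz cr] ->.
by rewrite -eq_porbit_mem porbit_step eq_porbit_mem xz permK crossed_wrap.
Qed.

End ColorArithmetic.

Lemma cdist_ordS_cases d (e a : 'I_d) :
  ((cdist e a).+1 < d /\ cdist e (ordS a) = (cdist e a).+1) \/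
  ((cdist e a).+1 = d /\ cdist e (ordS a) = 0).
Proof. cyclic_lia. Qed.

Lemma crossed_shift_cases d (e j a b : 'I_d) :
  (cdist e a <= cdist e b /\ crossed j a b = (cdist e a <= cdist e j < cdist e b)) \/
  (cdist e b < cdist e a /\ crossed j a b = (cdist e a <= cdist e j) || (cdist e j < cdist e b)).
Proof.
rewrite /crossed -(cdist_cshift e a j) -(cdist_cshift e a b).
rewrite [cdist (cshift e a) (cshift e b)]/cdist [cdist (cshift e a) (cshift e j)]/cdist /=.
have := cdist_lt e a; have := cdist_lt e b; have := cdist_lt e j.
move: (cdist e a) (cdist e b) (cdist e j) => x y z zd yd xd.
case: (leqP x y) => xy; [left|right]; split=> //; case: (leqP x z) => xz; apply/idP/idP; lia.
Qed.

Lemma crossed_ordS_ordS d (e j a b : 'I_d) : cdist e a <= cdist e b ->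
  crossed j (ordS a) (ordS b) = (cdist e a < cdist e j <= cdist e b).
Proof.
move=> ab; have := crossed_shift_cases e j (ordS a) (ordS b).
have := cdist_ordS_cases e a; have := cdist_ordS_cases e b.
have := cdist_lt e j; have := cdist_lt e b.
move: (crossed _ _ _) (cdist e (ordS a)) (cdist e (ordS b)) => c x y.
move: (cdist e a) (cdist e b) (cdist e j) ab => u v z uv vd zd.
by case=> -[? ?]; case=> -[? ?]; case=> -[? ->]; apply/idP/idP; lia.
Qed.

Lemma crossed_pred d (j a b : 'I_d) : crossed (ord_pred j) a b = (cdist j b < cdist j a).
Proof. by rewrite crossed_wrap ord_predK. Qed.

(** Counted from [j], the step from [j+1] to [j+2] is the one from 1 to 2. With [crossed_pred], this
    describes how the count enters and leaves the values at least 2. *)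
Lemma crossed_succ_cases d (j a b : 'I_d) : 1 < d ->
  (cdist j a <= cdist j b /\ crossed (ordS j) a b = (cdist j a <= 1 < cdist j b)) \/
  (cdist j b < cdist j a /\ crossed (ordS j) a b = (cdist j a <= 1) || (1 < cdist j b)).
Proof.
move=> d_gt1; have := crossed_shift_cases j (ordS j) a b.
by case: (cdist_ordS_cases j j); rewrite cdistaa => -[+ ->] //; lia.
Qed.

(** * Euler's relation for neighborhoods *)

Section Maps.
Variable M : cmap.
Implicit Types (h k : dart M) (U S R : {set {set dart M}}) (E : {set dart M}).
Local Notation opp := (Defs.opp M).

Lemma fcw_cw h : fcw M (cw M h) = opp h.
Proof. by rewrite /fcw permM permK. Qed.

Lemma fcwE h : fcw M h = opp ((cw M)^-1%g h).
Proof. by rewrite /fcw permM. Qed.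

Lemma fcwVE h : (fcw M)^-1%g h = cw M (opp h).
Proof. by apply: (canLR (permK _)); rewrite fcw_cw oppK. Qed.

Lemma face_cw h : face (cw M h) = face (opp h).
Proof. by rewrite -fcw_cw /face porbit_step. Qed.

Lemma vert_cw h : vert (cw M h) = vert h.
Proof. exact: porbit_step. Qed.

Lemma vert_cwV h : vert ((cw M)^-1%g h) = vert h.
Proof. exact: porbit_stepV. Qed.

Lemma face_fcw h : face (fcw M h) = face h.
Proof. exact: porbit_step. Qed.

Lemma edge_opp h : edge (opp h) = edge h.
Proof. by rewrite /edge oppK setUC. Qed.

Lemma mem_edge h k : (h \in edge k) = (edge h == edge k).
Proof.
apply/idP/eqP => [|<-]; last by rewrite !inE eqxx.
by rewrite !inE => /orP[] /eqP-> //; rewrite edge_opp.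
Qed.

Lemma edge_porbit h : porbit opp h = edge h.
Proof.
apply/setP=> k; apply/idP/idP => [/porbit_iterP[m _ ->]|].
  elim: m => [|m]; first by rewrite !inE eqxx.
  by rewrite !inE /= => /orP[/eqP->|/eqP->]; rewrite ?oppK eqxx ?orbT.
rewrite !inE => /orP[] /eqP->; first exact: porbit_id.
exact: (mem_porbit_iter _ 1).
Qed.

Lemma card_setI_edge (A : {set dart M}) h :
  #|A :&: edge h| = (h \in A) + (opp h \in A).
Proof.
rewrite -sum1_card (eq_bigl (fun k => (k \in A) && (k \in edge h))); last first.
  by move=> k; rewrite inE.
rewrite big_mkcondl /= /edge big_setU1 ?big_set1 /=; last first.
  by rewrite inE eq_sym opp_neq.
by case: (h \in A); case: (opp h \in A).
Qed.

Lemma card_darts : #|dart M| = #|porbits opp| * 2.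
Proof.
have := sum_porbits opp (fun=> 1); rewrite sum1_card => <-.
rewrite -sum_nat_const; apply: eq_bigr => e; case/porbitsP => h ->.
rewrite sum1_card edge_porbit /edge cards2.
by rewrite eq_sym opp_neq.
Qed.

Lemma vertP h k : reflect (vert h = vert k) (h \in vert k).
Proof. exact: eq_porbitP. Qed.

Lemma faceP h k : reflect (face h = face k) (h \in face k).
Proof. exact: eq_porbitP. Qed.

Lemma vert_in h : vert h \in vertices M.
Proof. exact: porbit_mem. Qed.

Lemma adjP E x y :
  reflect (exists2 h, h \in E & vert h = x /\ vert (opp h) = y) (adj E x y).
Proof.
apply: (iffP existsP) => [[h /and3P[hE /eqP ? /eqP ?]]|[h hE [<- <-]]].
  by exists h.
by exists h; rewrite hE !eqxx.
Qed.

(** Connectedness stated through two-colorings invariant under [cw] and [opp]: this form passes at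
    once to the dual map. *)
Definition dart_connected : Prop :=
  forall c : dart M -> bool, (forall h, c (cw M h) = c h) ->
    (forall h, c (opp h) = c h) -> forall h k, c h = c k.

Lemma connected_dart : connected M -> dart_connected.
Proof.
move=> con c ccw copp h k.
have cv h1 h2 : vert h1 = vert h2 -> c h1 = c h2.
  by move/vertP/(@porbit_const _ _ _ c)=> -> // z _.
have /connectP[p] := con _ _ (vert_in h) (vert_in k).
elim: p h => [|y p IH] h /= => [_ /cv-> //|/andP[/adjP[h1 _ [def_h <-]] pp] lst].
by rewrite -(cv _ _ def_h) -copp; apply: IH.
Qed.

Section Neighborhood.
Variable U : {set {set dart M}}.

Definition out_darts : {set dart M} := [set h | vert h \in U].
Definition nb_edges : {set {set dart M}} := [set edge h | h in out_darts].
Definition nb_faces : {set {set dart M}} := [set face h | h in out_darts].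

Hypotheses (con : dart_connected) (UV : U \subset vertices M).
Hypothesis proper : exists h, vert h \notin U.
Hypothesis nb_con : forall c : {set dart M} -> bool,
  (forall h, vert h \in U -> c (face h) = c (face (opp h))) ->
  forall h k, vert h \in U -> vert k \in U -> c (face h) = c (face k).

Import GRing.Theory.
Local Open Scope ring_scope.

(** Incidence matrices: an entry of [A] counts the ends of an edge at a vertex, an entry of [B] the
    sides of an edge on a face, both read off as common darts. *)
Let A : 'M['F_2]_(#|U|, #|nb_edges|) :=
  \matrix_(i, j) #|enum_val i :&: enum_val j|%:R.
Let B : 'M['F_2]_(#|nb_edges|, #|nb_faces|) :=
  \matrix_(j, k) #|enum_val k :&: enum_val j|%:R.

Let F2_cases (x : 'F_2) : x = 0 \/ x = 1.
Proof. by case: x => [[|[|]]] // ?; [left|right]; apply: val_inj. Qed.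

(** Turning around a vertex, each of its corners in the given face is counted by the two darts that
    bound it, hence twice. *)
Lemma incidence_mul0 : A *m B = 0.
Proof.
apply/matrixP=> i k; rewrite !mxE.
have /(subsetP UV)/porbitsP[hv def_v] := enum_valP i.
have /imsetP[hf _ def_f] := enum_valP k.
rewrite (eq_bigr (fun j => (#|enum_val i :&: enum_val j| *
                             #|enum_val k :&: enum_val j|)%:R)); last first.
  by move=> j _; rewrite !mxE natrM.
rewrite -(big_enum_val (fun e => (#|enum_val i :&: e| * #|enum_val k :&: e|)%:R)) /=.
have iU := enum_valP i.
move: (enum_val i) (enum_val k) def_v def_f iU => v f -> -> vU.
rewrite -natr_sum.
have -> : (\sum_(e in nb_edges) #|porbit (cw M) hv :&: e| * #|face hf :&: e|
          = \sum_(h in vert hv) #|face hf :&: edge h|)%N.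
  rewrite (partition_big (@edge M) (mem nb_edges)) /=; last first.
    move=> h /vertP hvE; apply: imset_f; by rewrite inE hvE.
  apply: eq_bigr => _ /imsetP[h _ ->].
  rewrite (eq_bigr (fun=> #|face hf :&: edge h|)) => [|h' /andP[_ /eqP->] //].
  rewrite sum_nat_const; congr (_ * _)%N; apply: eq_card => h'.
  by rewrite in_setI mem_edge.
under eq_bigr do rewrite card_setI_edge.
rewrite big_split /=.
have -> : (\sum_(h in vert hv) (opp h \in face hf)
          = \sum_(h in vert hv) (h \in face hf))%N.
  rewrite -[RHS](sum_porbit_step (cw M) (fun h => nat_of_bool (h \in face hf))).
  apply: eq_bigr => h _; congr nat_of_bool; rewrite -fcw_cw.
  by rewrite -!eq_porbit_mem porbit_step.
by rewrite addnn -muln2 natrM [2%:R](_ : _ = 0) ?mulr0 //; apply: val_inj.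
Qed.


(** A relation between the rows is a function on the vertices, zero outside [U], with equal values
    at both ends of each edge. It is constant by connectedness, hence zero as [U] is proper. *)
Lemma vertex_rows_free : row_free A.
Proof.
apply: inj_row_free => x xA0.
pose X v := \sum_i x 0 i * (enum_val i == v)%:R.
have Xe h : vert h \in U -> X (vert h) + X (vert (opp h)) = 0.
  move=> hU; have eU : edge h \in nb_edges by apply: imset_f; rewrite inE.
  move/rowP: xA0 => /(_ (enum_rank_in eU (edge h))); rewrite !mxE => <-.
  rewrite -big_split /=; apply: eq_bigr => i _.
  rewrite !mxE enum_rankK_in // card_setI_edge natrD mulrDr.
  have /(subsetP UV)/porbitsP[hv ->] := enum_valP i.
  by rewrite -!eq_porbit_mem ![_ == porbit _ hv]eq_sym.
have X0 v : v \notin U -> X v = 0.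
  move=> vU; apply: big1 => i _; case: eqP => [def_v|_]; last by rewrite mulr0.
  by rewrite -def_v enum_valP in vU.
have cX h : (X (vert h) == 0) = (X (vert (opp h)) == 0).
  case: (boolP (vert h \in U)) => [/Xe/eqP|hU].
    by rewrite addr_eq0 => /eqP->; rewrite oppr_eq0.
  case: (boolP (vert (opp h) \in U)) => [/Xe/eqP|ohU]; last by rewrite !X0.
  by rewrite oppK addr_eq0 => /eqP->; rewrite oppr_eq0.
have [h0 h0U] := proper.
have Xall h : X (vert h) = 0.
  apply/eqP; rewrite (@con (fun h => X (vert h) == 0) _ _ h h0) ?X0 // => k.
  by rewrite vert_cw.
apply/rowP=> i; rewrite mxE.
have /(subsetP UV)/porbitsP[hv def_v] := enum_valP i.
rewrite -(Xall hv) /X (bigD1 i) //= def_v eqxx mulr1 big1 ?addr0 // => j ij.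
case: eqP => [eq_ij|_]; last by rewrite mulr0.
by case/eqP: ij; apply: enum_val_inj; rewrite eq_ij.
Qed.

(** A vector in the kernel is a function on the faces incident to [U] with equal values on both
    sides of each edge incident to [U]; by [nb_con] it is constant, so the kernel has dimension at
    most 1. *)
Lemma face_rank : (#|nb_faces| <= \rank B + 1)%N.
Proof.
have kerB : (kermx B^T <= (const_mx 1 : 'rV_#|nb_faces|))%MS.
  apply/rV_subP => y /sub_kermxP yB0.
  pose Y f := \sum_i y 0 i * (enum_val i == f)%:R.
  have Ye h : vert h \in U -> (Y (face h) == 0) = (Y (face (opp h)) == 0).
    move=> hU; have eU : edge h \in nb_edges by apply: imset_f; rewrite inE.
    suff /eqP: Y (face h) + Y (face (opp h)) = 0.
      by rewrite addr_eq0 => /eqP->; rewrite oppr_eq0.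
    move/rowP: yB0 => /(_ (enum_rank_in eU (edge h))); rewrite !mxE => <-.
    rewrite -big_split /=; apply: eq_bigr => i _.
    rewrite !mxE enum_rankK_in // card_setI_edge natrD mulrDr.
    have /imsetP[hf _ ->] := enum_valP i.
    by rewrite -!eq_porbit_mem ![_ == porbit _ hf]eq_sym.
  have Yc := nb_con (c := fun f => Y f == 0) Ye.
  have Yi i : Y (enum_val i) = y 0 i.
    rewrite /Y (bigD1 i) //= eqxx mulr1 big1 ?addr0 // => j ij.
    case: eqP => [eq_ij|_]; last by rewrite mulr0.
    by case/eqP: ij; apply: enum_val_inj.
  case: (boolP [exists i, y 0 i != 0]) => [/existsP[i yi]|/existsPn y0]; last first.
    rewrite (_ : y = 0) ?sub0mx //; apply/rowP=> i; rewrite mxE; apply/eqP.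
    by move: (y0 i); rewrite negbK.
  rewrite (_ : y = const_mx 1) ?submx_refl //; apply/rowP=> j; rewrite mxE.
  have [|//] := F2_cases (y 0 j); move/eqP; rewrite -Yi.
  have /imsetP[hi] := enum_valP i; have /imsetP[hj] := enum_valP j; rewrite !inE.
  move=> hjU -> hiU def_i; rewrite (Yc _ _ hjU hiU) -def_i Yi.
  by rewrite (negPf yi).
have := leq_trans (mxrankS kerB) (rank_leq_row _).
by rewrite mxrank_ker mxrank_tr leq_subLR.
Qed.

(** As [A *m B = 0], the ranks of [A] and [B] add up to at most the number of edges. *)
Lemma neighborhood_bound : (#|U| + #|nb_faces| <= #|nb_edges| + 1)%N.
Proof.
have := mulmx0_rank_max incidence_mul0; have /eqP-> := vertex_rows_free.
have := face_rank; lia.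
Qed.

End Neighborhood.

End Maps.

(** * Reaching the roots *)

Section Reach.
Variable M : cmap.
Implicit Types (h k : dart M).
Local Notation opp := (Defs.opp M).
(** [E1] is to lead every vertex to [R], and [E2] is its companion, with arcs leaving the faces.
    They will be [xi L i] and [psi L i], then, in the dual map, [psi L i] and the reversed
    [xi L i]. *)
Variables (E1 E2 : {set dart M}) (R : {set {set dart M}}).

Hypotheses (con : dart_connected M) (M_planar : planar M).
Hypothesis E1_out : forall h, vert h \notin R -> exists2 k, k \in E1 & vert k = vert h.
Hypothesis E2_face : forall h, (forall k, k \in face h -> vert k \notin R) ->
  exists2 k, k \in E2 & face k = face h.
Hypothesis E12_disj : forall h, h \in E1 -> h \notin E2.
Hypothesis E12_opp : forall h, h \in E1 :|: E2 -> opp h \notin E1 :|: E2.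
Hypothesis R0 : exists h, vert h \in R.
Hypothesis R_con : forall c : {set dart M} -> bool,
  (forall h, vert h \in R -> c (face h) = c (face (opp h))) ->
  forall h k, vert h \in R -> vert k \in R -> c (face h) = c (face k).

Let U := [set x in vertices M | [exists y in R, linked E1 x y]].

Let sUV : U \subset vertices M.
Proof. by apply/subsetP=> x; rewrite inE => /andP[]. Qed.

Let inU h : (vert h \in U) = [exists y in R, linked E1 (vert h) y].
Proof. by rewrite inE vert_in. Qed.

Let R_U h : vert h \in R -> vert h \in U.
Proof. by move=> hR; rewrite inU; apply/existsP; exists (vert h); rewrite hR; apply: connect0. Qed.

Let U_step h : h \in E1 -> vert (opp h) \in U -> vert h \in U.
Proof.
rewrite !inU => hE /existsP[y /andP[yR lk]]; apply/existsP; exists y.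
by rewrite yR; apply: connect_trans lk; apply/connect1/adjP; exists h.
Qed.

(** The faces around a vertex of [U] are linked by its edges, and both ends of an arc of [E1] share
    a face; following [E1] thus leads to [R], where [R_con] applies. *)
Let U_con (c : {set dart M} -> bool) :
  (forall h, vert h \in U -> c (face h) = c (face (opp h))) ->
  forall h k, vert h \in U -> vert k \in U -> c (face h) = c (face k).
Proof.
move=> c_opp; have [h0 h0R] := R0.
have c_vert h k : vert h \in U -> vert k = vert h -> c (face k) = c (face h).
  move=> hU /vertP /(porbit_const (F := fun z => c (face z))); apply => z /vertP zh.
  by rewrite face_cw -c_opp // zh.
suff c0 h : vert h \in U -> c (face h) = c (face h0).
  by move=> h k hU kU; rewrite !c0.
move=> hU; have := hU; rewrite inU => /existsP[y /andP[yR /connectP[p]]].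
elim: p h hU => [|z p IH] h hU /=.
  by move=> _ def_y; apply: R_con; rewrite -?def_y // => k kR; apply: c_opp; apply: R_U.
case/andP=> /adjP[k kE [kh kz]] pp lst.
have ozU : vert (cw M (opp k)) \in U.
  rewrite vert_cw inU kz; apply/existsP; exists y; rewrite yR.
  by apply/connectP; exists p.
rewrite -(c_vert _ _ hU kh) -[k in face k](oppK k) -face_cw; apply: IH => //.
  by rewrite vert_cw kz.
by rewrite vert_cw kz.
Qed.

(* Otherwise let [U] be the set of vertices which do reach [R].  By Euler's
   relation, the vertices and faces which are not incident to [U] are more
   numerous than the edges which are not incident to [U], whereas [E1] and [E2]
   assign distinct such edges to them. *)
Lemma reach h : exists2 y, y \in R & linked E1 (vert h) y.
Proof.
suff: vert h \in U by rewrite inU => /existsP[y /andP[]]; exists y.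
apply: contraT => hU.
have := neighborhood_bound con sUV (ex_intro _ h hU) U_con.
set D1 := [set h in E1 | vert h \notin U].
set D2 := [set h in E2 | face h \notin nb_faces U].
have D1E : {subset D1 <= E1} by move=> k; rewrite inE => /andP[].
have D2E : {subset D2 <= E2} by move=> k; rewrite inE => /andP[].
have D12E k : k \in D1 :|: D2 -> k \in E1 :|: E2.
  by rewrite !(inE, in_setU) => /orP[] /andP[-> _]; rewrite ?orbT.
have D1_card : #|vertices M| - #|U| <= #|D1|.
  rewrite -(setIidPr sUV) -cardsD.
  apply: leq_trans (leq_imset_card (@vert M) (mem D1)); apply: subset_leq_card.
  apply/subsetP=> _ /setDP[/porbitsP[k ->] kU].
  have [|k' k'E k'k] := @E1_out k; first by apply: contra kU; apply: R_U.
  by apply/imsetP; exists k'; rewrite // inE k'E k'k.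
have D2_card : #|faces M| - #|nb_faces U| <= #|D2|.
  have nbF : nb_faces U \subset faces M.
    by apply/subsetP=> _ /imsetP[k _ ->]; apply: porbit_mem.
  rewrite -(setIidPr nbF) -cardsD.
  apply: leq_trans (leq_imset_card (@face M) (mem D2)); apply: subset_leq_card.
  apply/subsetP=> _ /setDP[/porbitsP[k ->] kU].
  have [k' k'k|k' k'E k'k] := @E2_face k.
    apply: contra kU => /R_U k'U; apply/imsetP; exists k'; first by rewrite inE.
    by symmetry; apply/faceP.
  by apply/imsetP; exists k'; rewrite // inE k'E k'k.
have D_edges : #|D1| + #|D2| <= #|porbits opp| - #|nb_edges U|.
  have nbE : nb_edges U \subset porbits opp.
    by apply/subsetP=> _ /imsetP[k _ ->]; rewrite -edge_porbit; apply: porbit_mem.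
  rewrite -(setIidPr nbE) -cardsD.
  have -> : #|D1| + #|D2| = #|D1 :|: D2|.
    rewrite cardsU (_ : D1 :&: D2 = set0) ?cards0 ?subn0 //.
    by apply/setP=> k; rewrite in_setI in_set0; apply/andP => -[/D1E/E12_disj/negP + /D2E].
  rewrite -(card_in_imset (f := @edge M)); last first.
    move=> k1 k2 /D12E k1D /D12E k2D /eqP; rewrite -mem_edge !inE.
    by case/orP=> /eqP // k12; rewrite k12 (negPf (E12_opp k2D)) in k1D.
  apply: subset_leq_card; apply/subsetP=> _ /imsetP[k kD ->].
  rewrite inE -{2}edge_porbit porbit_mem andbT.
  (* An arc of [E1] ending in [U] also starts in [U], and an edge with an end in [U] has both its
     faces in [nb_faces U]. *)
  apply/imsetP => -[k' k'U /eqP]; rewrite -mem_edge; move: k'U; rewrite inE => k'U.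
  move: kD; rewrite in_setU => /orP[]; rewrite inE.
    case/andP=> kE kU; rewrite !inE => /orP[]/eqP def_k.
      by rewrite -def_k (negPf kU) in k'U.
    case/negP: kU; apply: U_step => //; by rewrite def_k oppK.
  case/andP=> kE kU; rewrite !inE => /orP[]/eqP def_k; case/negP: kU; apply/imsetP.
    by exists k'; [rewrite inE | rewrite def_k].
  by exists (cw M k'); [rewrite inE vert_cw | rewrite def_k face_cw].
have := subset_leq_card sUV; move: M_planar; rewrite /planar.
have : #|nb_edges U| <= #|porbits opp|.
  apply: subset_leq_card.
  by apply/subsetP=> _ /imsetP[k _ ->]; rewrite -edge_porbit; apply: porbit_mem.
have : #|nb_faces U| <= #|faces M|.
  by apply: subset_leq_card; apply/subsetP=> _ /imsetP[k _ ->]; apply: porbit_mem.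
lia.
Qed.

End Reach.

(** * Rooted forests *)

Section Forests.
Variable M : cmap.
Implicit Types (h k : dart M) (x y z : {set dart M}).
Local Notation opp := (Defs.opp M).
Variables (E : {set dart M}) (S R : {set {set dart M}}).

Lemma in_und h : (h \in und E) = (h \in E) || (opp h \in E).
Proof.
rewrite in_setU; congr (_ || _); apply/imsetP/idP => [[k kE ->]|hE].
  by rewrite oppK.
by exists (opp h); rewrite ?oppK.
Qed.

Lemma und_opp h : (opp h \in und E) = (h \in und E).
Proof. by rewrite !in_und oppK orbC. Qed.

Lemma linked_first x y : linked E x y ->
  x = y \/ exists h, [/\ h \in E, vert h = x & linked E (vert (opp h)) y].
Proof.
case/connectP=> -[|z p] /=; first by move=> _ ->; left.
case/andP=> /adjP[h hE [hx hz]] pp ->; right; exists h; split=> //.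
by apply/connectP; exists p; rewrite hz.
Qed.

Lemma linked_arc h : h \in E -> linked E (vert h) (vert (opp h)).
Proof. by move=> hE; apply/connect1/adjP; exists h. Qed.

Lemma linked_und x y : linked E x y -> linked (und E) x y.
Proof.
apply: connect_sub => {x y} x y /adjP[h hE hxy]; apply/connect1/adjP.
by exists h; rewrite ?in_und ?hE.
Qed.

Lemma path_darts h x p : path (adj E) x p -> vert (opp h) = x ->
  exists s : seq (dart M), [/\ {subset s <= E}, map (@vert M) s = belast x p,
    path [rel h k | vert (opp h) == vert k] h s & vert (opp (last h s)) = last x p].
Proof.
elim: p h x => [|z p IH] h x /=; first by exists [::].
case/andP=> /adjP[k kE [kx kz]] /(IH k)/(_ kz)[s [sE sv ps lst]] hx.
exists (k :: s); split=> //=; last by rewrite hx kx eqxx.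
  by move=> h'; rewrite inE => /orP[/eqP->|/sE].
by rewrite kx sv.
Qed.

(* Such an arc would close a cycle with the path from its head to the root. *)
Lemma root_no_out h : rooted_forest E S R -> h \in E -> vert h \notin R.
Proof.
case=> E_opp E_S E_acyclic _ E_lk hE; apply/negP => hR.
have [hS ohS] := E_S h hE.
have lk : linked E (vert (opp h)) (vert h).
  apply: E_lk => //; apply/connect1/adjP; exists (opp h); last by rewrite oppK.
  by rewrite und_opp in_und hE.
have /connectP[p0 pp0 def_h] := lk; case/shortenP: pp0 def_h => p pp p_uniq _ def_h.
have [s [sE sv ps lst]] := path_darts pp (erefl _).
have cE : {subset h :: s <= E} by move=> k; rewrite inE => /orP[/eqP->|/sE].
have v_uniq : uniq (map (@vert M) (h :: s)).
  by rewrite /= sv def_h -rcons_uniq -lastI.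
suff: h :: s = [::] by [].
apply: E_acyclic => //.
- by move=> k /cE kE; rewrite in_und kE.
- by rewrite /= rcons_path ps /= lst def_h eqxx.
rewrite map_inj_in_uniq ?(map_uniq v_uniq) // => k k' /cE kE /cE k'E /eqP.
rewrite -mem_edge !inE => /orP[/eqP//|/eqP def_k].
by rewrite def_k (negPf (E_opp _ k'E)) in kE.
Qed.

Lemma map_uniq_inj (T1 T2 : eqType) (f : T1 -> T2) s :
  uniq (map f s) -> {in s &, injective f}.
Proof.
elim: s => [|a s IH] //= /andP[fa us] x y; rewrite !inE.
case/predU1P=> [->|xs] /predU1P[->|ys] //; last exact: IH.
  by move=> fay; case/mapP: fa; exists y.
by move=> fax; case/mapP: fa; exists x.
Qed.

Hypothesis E_fun : {in E &, forall h k, vert h = vert k -> h = k}.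
Hypothesis E_opp : forall h, h \in E -> opp h \notin E.
Hypothesis E_R : forall h, h \in E -> vert h \notin R.
Hypothesis E_S : forall h, h \in E -> vert h \in S /\ vert (opp h) \in S.
Hypothesis E_reach : forall x, x \in S -> exists2 y, y \in R & linked E x y.

Lemma linked_step h y : h \in E -> linked E (vert h) y -> y != vert h ->
  linked E (vert (opp h)) y.
Proof.
move=> hE /linked_first[<-|[k [kE kh lk]]]; first by rewrite eqxx.
by rewrite (E_fun hE kE).
Qed.

Lemma linked_root_step h y : h \in E -> y \in R ->
  linked E (vert h) y = linked E (vert (opp h)) y.
Proof.
move=> hE yR; apply/idP/idP => [lk|]; last by apply: connect_trans (linked_arc hE).
by apply: linked_step => //; apply: contraTneq yR => ->; apply: E_R.
Qed.

Lemma linked_root y z : y \in R -> linked E y z -> y = z.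
Proof.
by move=> yR /linked_first[|[h [/E_R + hy _]]] //; rewrite hy yR.
Qed.

(** Otherwise every vertex reached from the tail of [h] would lead back to it, even the root, which
    has no outgoing arc. *)
Lemma linked_irrefl h : h \in E -> ~~ linked E (vert (opp h)) (vert h).
Proof.
move=> hE; apply/negP => back.
have [y yR lk] := E_reach (E_S hE).1.
suff: linked E y (vert h).
  by move/(linked_root yR) => def_y; case/negP: (E_R hE); rewrite -def_y.
suff back_all p x : path (adj E) x p -> linked E x (vert h) ->
    linked E (last x p) (vert h).
  by case/connectP: lk => p pp ->; apply: back_all => //; apply: connect0.
elim: p x => //= z p IH x /andP[/adjP[k kE [<- <-]] pp] lk_k; apply: IH => //.
case: (eqVneq (vert h) (vert k)) => [hk|hk]; last exact: linked_step.
by rewrite -(E_fun hE kE hk).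
Qed.

Definition depth x := #|[set z | linked E x z]|.

Lemma depth_lt h : h \in E -> depth (vert (opp h)) < depth (vert h).
Proof.
move=> hE; apply: proper_card; apply/properP; split.
  by apply/subsetP=> z; rewrite !inE; apply: connect_trans (linked_arc hE).
exists (vert h); rewrite !inE; first exact: connect0.
exact: linked_irrefl.
Qed.

(* Both edges of a cycle at a vertex of maximal depth would have to be its only
   outgoing arc. *)
Lemma und_acyclic : acyclic (und E).
Proof.
case=> // h0 c0; set c := h0 :: c0 => cE c_cyc _ c_uniq.
have h0c : h0 \in c by rewrite inE eqxx.
pose h := [arg max_(h > h0 in c) depth (vert h)].
have [hc h_max] : h \in c /\ forall k, k \in c -> depth (vert k) <= depth (vert h).
  by rewrite /h; case: arg_maxnP => // h1 h1c h1_max; split.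
have nc : next c h \in c by rewrite mem_next.
have pc : prev c h \in c by rewrite mem_prev.
have /eqP hn := next_cycle c_cyc hc; have /eqP ph := prev_cycle c_cyc hc.
have hE : h \in E.
  have := cE _ hc; rewrite in_und => /orP[//|/depth_lt]; rewrite oppK hn.
  by rewrite ltnNge h_max.
have oE : opp (prev c h) \in E.
  have := cE _ pc; rewrite in_und => /orP[/depth_lt|//]; rewrite ph.
  by rewrite ltnNge h_max.
have def_h := E_fun oE hE ph.
have eq_e : edge (prev c h) = edge h by rewrite -[in RHS]def_h edge_opp.
have := map_uniq_inj c_uniq pc hc eq_e; move: def_h => + eq_h; rewrite eq_h => /eqP.
by rewrite (negPf (opp_neq h)).
Qed.

(** Both ends of an arc lead to the same roots, so an undirected walk to a root can be replaced by a
    directed one, and each vertex reaches a single root. *)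
Lemma functional_rooted_forest : R \subset S -> rooted_forest E S R.
Proof.
move=> sRS.
have lk_und x y : y \in R -> linked (und E) x y -> linked E x y.
  move=> yR /connectP[p]; elim: p x => [|z p IH] x /=; first by move=> _ ->; apply: connect0.
  case/andP=> /adjP[h + [<- <-]] pp lst; rewrite in_und => /orP[] hE.
    by rewrite linked_root_step ?IH.
  have := linked_root_step hE yR; rewrite oppK => <-; exact: IH.
split=> // [|x xS|x y _]; [exact: und_acyclic| |exact: lk_und].
have [y yR lk] := E_reach xS.
apply/eqP/cards1P; exists y; apply/setP=> z; rewrite !inE.
apply/andP/eqP => [[zR /(lk_und _ _ zR) lkz]|->]; last by split=> //; apply: linked_und.
suff: linked E y z by move/(linked_root yR).
case/connectP: lk lkz => p pp def_y lkz; rewrite {}def_y in yR *.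
elim: p x {xS} pp yR lkz => //= w p IH x /andP[/adjP[h hE [<- <-]] pp] yR lkz.
by apply: IH => //; rewrite -linked_root_step.
Qed.

End Forests.

Lemma orient_toward_und (M : cmap) (E : {set dart M}) (S : {set {set dart M}}) y :
  {in E &, forall h k, vert h = vert k -> h = k} ->
  rooted_forest E S [set y] -> orient_toward y (und E) = E.
Proof.
move=> E_fun E_for; have [E_opp E_S _ E_card E_lk] := E_for.
have E_R h : h \in E -> vert h \notin [set y] by move=> hE; apply: root_no_out E_for hE.
have E_reach x : x \in S -> exists2 z, z \in [set y] & linked E x z.
  move=> xS; have /eqP/cards1P[z /setP/(_ z)] := E_card x xS; rewrite !inE eqxx.
  by case/andP=> /eqP-> lk; exists y; rewrite ?set11 //; apply: E_lk; rewrite ?set11.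
apply/setP=> h; rewrite inE in_und; case: (boolP (h \in E)) => [hE|hE] /=.
  have [_ /set1P-> /connectP[p pp def_y]] := E_reach _ (E_S _ hE).2.
  have := depth_lt E_fun E_R E_S E_reach hE; rewrite {}def_y.
  elim: p (vert (Defs.opp M h)) pp => [|w p IH] x /=; first by move=> *; apply: connect0.
  case/andP=> /adjP[k kE [kx kw]] pp lt_x; apply: (@connect_trans _ _ w).
    apply/connect1/adjP; exists k => //; rewrite in_setD in_und kE andbT !inE.
    apply/norP; split; first by apply: contraTneq lt_x => <-; rewrite kx ltnn.
    by apply: contraTneq kE => ->; apply: E_opp.
  apply: IH => //; apply: ltn_trans lt_x; rewrite -kx -kw; exact: (depth_lt E_fun E_R E_S).
apply/negP => /andP[ohE /connectP[p pp def_y]].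
have: linked E y (vert (Defs.opp M h)).
  suff back_all x : path (adj (und E :\: edge h)) x p ->
      linked E x (vert (Defs.opp M h)) -> linked E (last x p) (vert (Defs.opp M h)).
    by rewrite def_y; apply: back_all => //; apply: connect0.
  elim: p {pp def_y} x => //= w p IH x /andP[/adjP[k + [kx kw]] pp] lk.
  rewrite in_setD in_und !inE => /andP[/norP[kh kh'] kE]; apply: IH => //; case/orP: kE => kE.
    rewrite -kw; apply: linked_step => //; first by rewrite kx.
    by apply: contraNneq kh' => /(E_fun _ _ ohE kE)->.
  by apply: connect_trans lk; rewrite -kx -kw -{2}[k]oppK; apply: linked_arc.
move/(linked_root E_R (set11 y)) => def_h; have := E_R _ ohE.
by rewrite -def_h set11.
Qed.

Lemma cdist_iter_ordS d m (a : 'I_d) : m < d -> cdist a (iter m (@ordS d) a) = m.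
Proof.
elim: m => [|m IH] lt_m /=; first exact: cdistaa.
have := IH (ltnW lt_m); move: lt_m; move: (iter m _ a) => b; cyclic_lia.
Qed.

Lemma iter_ordS_cdist d (a b : 'I_d) : iter (cdist a b) (@ordS d) a = b.
Proof. by apply: (cdistK (a := a)); apply: cdist_iter_ordS; apply: cdist_lt. Qed.

(** * Labellings of regular plane graphs *)

Section Labellings.
Variables (d : nat) (M : cmap) (r : dart M).
Hypotheses (d_gt2 : 2 < d) (M_plane : plane_graph M) (M_regular : regular M d).
Implicit Types (h k : dart M) (i j : 'I_d) (L : {ffun dart M -> 'I_d}).
Local Notation opp := (Defs.opp M).
Local Notation root := (root_vertex r).
Local Notation redge := (@root_edge d M r).
Local Notation rface := (@root_face d M r).

Lemma vert_root_edge i : vert (redge i) = root.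
Proof.
rewrite /root_edge; elim: (nat_of_ord i) => //= n IH.
by rewrite vert_cwV.
Qed.

Lemma cw_root_edge i : cw M (redge (ordS i)) = redge i.
Proof.
rewrite /root_edge; case: (ordS_cases i) => -[] => [i_max ->|_ ->] /=; last first.
  by rewrite permKV.
have := iter_porbit (cw M)^-1%g r; rewrite porbitV -/(vert r) M_regular.
move: (nat_of_ord i) i_max => n <- /= /(congr1 (cw M)).
by rewrite permKV.
Qed.

Lemma root_edgeP h : vert h = root -> exists i, h = redge i.
Proof.
move/vertP; rewrite /root_vertex /vert -porbitV => /porbit_iterP[m].
by rewrite porbitV -/(vert r) M_regular => lt_m ->; exists (Ordinal lt_m).
Qed.

Lemma vert_opp_root_edge i : vert (opp (redge i)) != root.
Proof. by rewrite -(vert_root_edge i); case: M_plane. Qed.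

Lemma mem_root_face_opp i : opp (redge i) \in rface i.
Proof. by rewrite -fcw_cw /rface; apply: (mem_porbit_iter _ 1). Qed.

Lemma mem_root_face i : redge i \in rface (ordS i).
Proof. by rewrite /rface cw_root_edge porbit_id. Qed.

Lemma root_face_in i : rface i \in faces M.
Proof. exact: porbit_mem. Qed.

Lemma nonroot_face_vert f h : f \in faces M -> (forall i, f != rface i) ->
  h \in f -> vert h != root.
Proof.
move=> fF f_nr; rewrite (porbits_mem _ fF) => /eqP def_f.
apply/eqP => /root_edgeP[i def_h]; case/eqP: (f_nr (ordS i)).
by rewrite -def_f def_h; apply/faceP; apply: mem_root_face.
Qed.

(** What is known of a labelling before its behavior around whole faces: the turning colors at
    vertices, and condition (ii) at two corners next to each root-edge. It suffices for
    [labelling_count]. *)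
Definition local_labelling L :=
  [/\ forall h, vert h != root -> L (cw M h) = ordS (L h),
      forall i, L (cw M (redge i)) = i
    & forall i, L (opp (redge i)) = i].

Definition descents L (f : {set dart M}) := #|[set h in f | L (fcw M h) < L h]|.

Definition inner h := (vert h != root) && (vert (opp h) != root).

(** The edges that would have both orientations in the same tree, recorded by both of their
    darts. *)
Definition clashes L := [set h | inner h && (L h == L (opp h))].

Lemma inner_opp h : inner (opp h) = inner h.
Proof. by rewrite /inner oppK andbC. Qed.

Lemma inner_ind (P : dart M -> Prop) :
  (forall h, inner h -> P h) -> (forall i, P (redge i)) ->
  (forall i, P (opp (redge i))) -> forall h, P h.
Proof.
move=> P_in P_r P_o h; case: (boolP (inner h)) => [/P_in //|].
rewrite negb_and !negbK => /orP[] /eqP/root_edgeP[i]; first by move->.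
by move/(canRL (@oppK M))->.
Qed.

Lemma inner_root_edge i : inner (redge i) = false.
Proof. by rewrite /inner vert_root_edge eqxx. Qed.

Section Local.
Variable L : {ffun dart M -> 'I_d}.
Hypothesis L_loc : local_labelling L.

Lemma local_cw h : vert h != root -> L (cw M h) = ordS (L h).
Proof. by case: L_loc => Lcw _ _; apply: Lcw. Qed.

Lemma local_cw_root i : L (cw M (redge i)) = i.
Proof. by case: L_loc. Qed.

Lemma local_opp_root i : L (opp (redge i)) = i.
Proof. by case: L_loc. Qed.

Lemma local_root i : L (redge i) = ordS i.
Proof. by rewrite -cw_root_edge local_cw_root. Qed.

(** Corner [opp h] follows corner [cw h] around their face, so this is the increment of color along
    one side of the edge. *)
Definition jump h := cdist (L (cw M h)) (L (opp h)).

Lemma jump_root i : jump (redge i) = 0.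
Proof. by rewrite /jump local_cw_root local_opp_root cdistaa. Qed.

Lemma jump_opp_root i : jump (opp (redge i)) = 0.
Proof.
by rewrite /jump oppK local_cw ?vert_opp_root_edge // local_opp_root local_root cdistaa.
Qed.

(** With [a] and [b] the colors of the two arcs of an inner edge, the jumps are [b-a-1] and [a-b-1]
    modulo [d]: they add up to [d-2] if [a] and [b] differ, and both are [d-1] otherwise. *)
Lemma jumpE h : jump h + jump (opp h) =
  (if inner h then d - 2 else 0) + (if h \in clashes L then d else 0).
Proof.
rewrite inE; elim/inner_ind: h => [h hin|i|i].
- rewrite hin /jump oppK; case/andP: hin => h1 h2.
  rewrite !local_cw // -val_eqE /=; move: (L h) (L (opp h)) d_gt2 => a b.
  by case: eqVneq; cyclic_lia.
- by rewrite inner_root_edge jump_root jump_opp_root.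
by rewrite inner_opp oppK inner_root_edge jump_root jump_opp_root.
Qed.

Lemma card_inner : #|[set h | inner h]| + 2 * d = #|dart M|.
Proof.
pose A := [set h | vert h == root]; pose B := [set h | vert (opp h) == root].
have cA : #|A| = d.
  rewrite -(M_regular r); apply: eq_card => h; rewrite inE; exact/eqP/vertP.
have cB : #|B| = d.
  rewrite -cA -(card_imset _ (@perm_inj _ opp)); apply: eq_card => h.
  apply/imsetP/idP => [[k + ->]|]; rewrite !inE ?oppK // => hr.
  by exists (opp h); rewrite ?inE oppK.
have AB0 : A :&: B = set0.
  apply/setP=> h; rewrite !inE; apply/andP => -[/eqP/root_edgeP[i ->]].
  by rewrite (negPf (vert_opp_root_edge i)).
rewrite -(cardsC [set h | inner h]); congr (_ + _).
rewrite (_ : ~: _ = A :|: B); first by rewrite cardsU AB0 cards0 cA cB; lia.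
by apply/setP=> h; rewrite !inE negb_and !negbK.
Qed.

Lemma card_darts_regular : #|dart M| = d * #|vertices M|.
Proof.
have := sum_porbits (cw M) (fun=> 1); rewrite sum1_card => <-.
rewrite mulnC -sum_nat_const; apply: eq_bigr => v /porbitsP[h ->].
by rewrite sum1_card M_regular.
Qed.

(** The total increment is computed around faces, where each descent is worth [d], and along edges
    by [jumpE]; Euler's relation and regularity do the rest. *)
Lemma labelling_count :
  2 * \sum_(f in faces M) descents L f + 2 * d = 2 * #|faces M| + #|clashes L|.
Proof.
have S1 : \sum_h jump h = d * \sum_(f in faces M) descents L f.
  rewrite big_distrr /= (eq_bigr (fun f : {set dart M} =>
    \sum_(h in f) cdist (L h) (L (fcw M h)))); last first.
    by move=> f /porbitsP[h ->]; rewrite sum_cdist.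
  rewrite sum_porbits -[RHS](sum_perm (cw M)); apply: eq_bigr => h _.
  by rewrite fcw_cw.
have S2 : 2 * \sum_h jump h = (d - 2) * #|[set h | inner h]| + d * #|clashes L|.
  rewrite mul2n -addnn -{2}(sum_perm opp) -big_split /=.
  under eq_bigr do rewrite jumpE.
  rewrite big_split /= -!big_mkcond /= !sum_nat_const; congr (_ + _); last exact: mulnC.
  by rewrite mulnC; congr (_ * _); apply: eq_card => h; rewrite inE.
have [_ _] := M_plane; rewrite /planar => euler.
have N1 := card_inner; have N2 := card_darts_regular; have N3 := card_darts M.
rewrite S1 in S2.
have d_gt0 : 0 < d by apply: leq_trans d_gt2.
apply/eqP; rewrite -(eqn_pmul2l d_gt0); apply/eqP.
move: (\sum_(f in faces M) descents L f) S2 => S.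
move: #|clashes L| #|[set h | inner h]| N1 N2 N3 euler => b I.
move: #|dart M| #|porbits opp| #|vertices M| #|faces M| => N m V F N1 N2 N3 euler S2.
have N4 : I = 2 * V + 2 * F - 4 - 2 * d by lia.
(* This is [I + 2 * d = d * V] doubled, with [(d - 2) * I] isolated as in [S2]. *)
have : d * I + 4 * d = (d - 2) * I + 2 * (d * V) by nia.
nia.
Qed.

Lemma label_iter m h : vert h != root -> L (iter m (cw M) h) = iter m (@ordS d) (L h).
Proof.
by move=> hr; elim: m => //= m IH; rewrite local_cw ?IH // /vert porbit_iter.
Qed.

Lemma xi_out i h : vert h != root -> exists2 k, k \in xi r L i & vert k = vert h.
Proof.
move=> hr; exists (iter (cdist (L h) i) (cw M) h); last exact: porbit_iter.
by rewrite ffunE inE label_iter // iter_ordS_cdist eqxx andbT /vert porbit_iter.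
Qed.

Lemma xi_fun i : {in xi r L i &, forall h k, vert h = vert k -> h = k}.
Proof.
move=> h k; rewrite ffunE !inE => /andP[hr /eqP hi] /andP[kr /eqP ki] hk.
have /vertP/porbit_iterP[m] := esym hk; rewrite -/(vert h) M_regular => lt_m def_k.
have := cdist_iter_ordS (L h) lt_m; rewrite -label_iter // -def_k ki hi cdistaa.
by move=> m0; rewrite def_k -m0.
Qed.

End Local.

(* As an arc of the dual, [h] leaves its face between the corners [fcw^-1 h] and
   [h]. *)
Definition psi L : {ffun 'I_d -> {set dart M}} :=
  [ffun j => [set h | crossed j (L ((fcw M)^-1%g h)) (L h)]].

Lemma in_psi L j h : (h \in psi L j) = crossed j (L (cw M (opp h))) (L h).
Proof. by rewrite ffunE inE fcwVE. Qed.

Definition root_faces := [set rface i | i : 'I_d].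

Lemma root_facesP f : reflect (exists i, f = rface i) (f \in root_faces).
Proof. by apply: (iffP imsetP) => [[i _ ->]|[i ->]]; exists i. Qed.

Lemma root_facesPn f : reflect (forall i, f != rface i) (f \notin root_faces).
Proof.
apply: (iffP idP) => [fR i|fR]; first by apply: contraNneq fR => ->; apply: imset_f.
by apply/root_facesP => -[i def_f]; case/eqP: (fR i).
Qed.

Lemma root_faces_sub : root_faces \subset faces M.
Proof. by apply/subsetP=> _ /root_facesP[i ->]; apply: root_face_in. Qed.

Lemma regular_local L : regular_labelling r L -> local_labelling L.
Proof.
case=> Lcw _ Lf _; split=> // i; apply: Lf; first exact: porbit_id.
exact: mem_root_face_opp.
Qed.

Lemma psi_root L i j : local_labelling L ->
  (redge i \in psi L j = false) * (opp (redge i) \in psi L j = false).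
Proof.
move=> L_loc; rewrite !in_psi oppK (local_cw L_loc) ?vert_opp_root_edge //.
by rewrite local_opp_root ?local_root // local_cw_root ?crossedaa.
Qed.

Lemma psi_inner L h j : local_labelling L -> h \in psi L j -> inner h.
Proof. by move=> L_loc; elim/inner_ind: h => // i; rewrite psi_root. Qed.

Lemma in_psi_inner L h j : local_labelling L -> inner h -> h \notin clashes L ->
  (h \in psi L j) = (0 < cdist j (L h) < cdist j (L (opp h))).
Proof.
move=> L_loc hin; rewrite inE hin /= in_psi => neq_h.
by case/andP: hin => _ hr; rewrite (local_cw L_loc) // crossed_ordS.
Qed.

Lemma clashes_opp L h : (opp h \in clashes L) = (h \in clashes L).
Proof. by rewrite !inE inner_opp oppK eq_sym. Qed.

(** Among the colors other than [L h] and [L (opp h)], those from which going up meets [L h] first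
    belong to [h] in [psi], and the others to [opp h]. *)
Lemma edge_colors L h j : local_labelling L -> inner h -> h \notin clashes L ->
  (h \in psi L j) + (opp h \in psi L j) + (L h == j) + (L (opp h) == j) = 1.
Proof.
move=> L_loc hin h_ok; rewrite !in_psi_inner ?inner_opp ?clashes_opp // oppK.
move: h_ok; rewrite inE hin /= => neq_h.
have /eqP neq_c : cdist j (L h) != cdist j (L (opp h)).
  by apply: contraNneq neq_h => /cdistK->.
rewrite ![L _ == j]eq_sym -!cdist_eq0; lia.
Qed.

(** * The trees of a regular labelling *)

Section Regular.
Variable L : {ffun dart M -> 'I_d}.
Hypothesis L_reg : regular_labelling r L.
Let L_loc := regular_local L_reg.

Lemma label_root_face i h : h \in rface i -> L h = i.
Proof. by case: L_reg => _ _ Lf _; apply: Lf. Qed.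

Lemma root_face_inj : injective rface.
Proof.
move=> i j ij; have ci : cw M (redge i) \in rface i by apply: porbit_id.
by rewrite -(label_root_face ci); apply: label_root_face; rewrite -ij.
Qed.

Lemma descents_nonroot f : f \in faces M -> f \notin root_faces -> descents L f = 1.
Proof. by move=> fF /root_facesPn; case: L_reg => _ _ _; apply. Qed.

(** The [d] root-faces are distinct and have no descent; with one descent at each other face,
    [labelling_count] leaves nothing for the clashes. *)
Lemma no_clash h : h \notin clashes L.
Proof.
have card_rf : #|root_faces| = d by rewrite card_imset ?card_ord //; apply: root_face_inj.
have := labelling_count L_loc.
have -> : \sum_(f in faces M) descents L f = #|faces M| - d.
  have -> : #|faces M| - d = #|faces M :\: root_faces|.
    by rewrite cardsD (setIidPr root_faces_sub) card_rf.
  rewrite (bigID (mem root_faces)) /=.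
  rewrite big1 => [|f /andP[_ /root_facesP[i ->]]].
    rewrite -sum1_card; apply: eq_big => [f|f /andP[]]; last exact: descents_nonroot.
    by rewrite inE andbC.
  apply/eqP; rewrite cards_eq0; apply/eqP/setP=> k; rewrite !inE.
  case: (boolP (k \in _)) => //= ki; rewrite !(@label_root_face i) ?ltnn //.
  by rewrite /root_face; apply/faceP; rewrite face_fcw; apply/faceP.
have := subset_leq_card root_faces_sub; rewrite card_rf => le_d count.
suff b0 : #|clashes L| = 0 by rewrite (cards0_eq b0) inE.
by move: le_d count; move: #|faces M| #|clashes L| => F b; lia.
Qed.

Lemma psi_face i h : face h \notin root_faces ->
  exists2 k, k \in psi L i & face k = face h /\
    forall k', k' \in psi L i -> face k' = face h -> k' = k.
Proof.
move=> h_nr; have := descents_nonroot (porbit_mem _ _) h_nr.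
rewrite /descents /face -(card_orbit_crossed _ _ _ i) => /eqP/cards1P[k /setP def_k].
have in_k k' : face k' = face h -> (k' \in psi L i) = (k' == k).
  move=> /faceP hk'; have := def_k k'; rewrite !inE -/(face h) hk' /= => <-.
  by rewrite in_psi -fcwVE.
have := def_k k; rewrite set11 inE => /andP[/faceP hk _].
exists k => [|]; first by rewrite in_k.
by split=> // k' k'i k'h; apply/eqP; rewrite -in_k.
Qed.

Lemma xi_psi_disj i h : h \in xi r L i -> (h \notin psi L i) && (opp h \notin psi L i).
Proof.
rewrite ffunE inE => /andP[hr /eqP hi]; elim/inner_ind: h hr hi => [h hin|j|j] hr hi.
- have := edge_colors i L_loc hin (no_clash h); rewrite hi eqxx.
  by case: (h \in _); case: (opp h \in _); case: (_ == _).
- by rewrite vert_root_edge eqxx in hr.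
by rewrite oppK !psi_root.
Qed.

Lemma psi_antisym i h : h \in psi L i -> opp h \notin psi L i.
Proof.
move=> hi; have hin := psi_inner L_loc hi.
have := edge_colors i L_loc hin (no_clash h); rewrite hi.
by case: (opp h \in _).
Qed.

Lemma xi_antisym i h : h \in xi r L i -> opp h \notin xi r L i.
Proof.
rewrite !ffunE !inE => /andP[hr /eqP hi]; apply/andP => -[ohr ohi].
by have := no_clash h; rewrite inE /inner hr ohr hi eq_sym ohi.
Qed.

Lemma vert_face_const (c : {set dart M} -> bool) h k :
  (forall z, vert z = vert h -> c (face z) = c (face (opp z))) ->
  vert k = vert h -> c (face k) = c (face h).
Proof.
move=> c_opp /vertP /(porbit_const (F := fun z => c (face z))); apply => z /vertP zh.
by rewrite face_cw -c_opp.
Qed.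

Lemma xi_reach i h : linked (xi r L i) (vert h) root.
Proof.
have [_ /connected_dart con planar] := M_plane.
have [||||||y /set1P-> //] := @reach M (xi r L i) (psi L i) [set root] con planar _ _ _ _ _ _ h.
- by move=> k; rewrite inE; apply: xi_out.
- move=> k k_nr; have [|k' k'i [k'k _]] := @psi_face i k; last by exists k'.
  apply/root_facesP => -[j def_k].
  have /k_nr : redge (ord_pred j) \in face k.
    by rewrite def_k -{2}[j]ord_predK mem_root_face.
  by rewrite inE vert_root_edge eqxx.
- by move=> k /xi_psi_disj/andP[].
- move=> k; rewrite !in_setU negb_or => /orP[ki|ki].
    by rewrite xi_antisym //; case/andP: (xi_psi_disj ki).
  rewrite psi_antisym // andbT; apply/negP => /xi_psi_disj.
  by rewrite oppK ki andbF.
- by exists r; rewrite set11.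
- move=> c c_opp k1 k2 /set1P k1r /set1P k2r; apply: vert_face_const; last by rewrite k1r.
  by move=> z zr; apply: c_opp; rewrite inE zr k2r.
Qed.

Lemma xi_spanning_tree i : spanning_tree (xi r L i) root.
Proof.
apply: functional_rooted_forest.
- exact: xi_fun.
- exact: xi_antisym.
- by move=> h; rewrite ffunE !inE => /andP[].
- by move=> h _; rewrite !vert_in.
- by move=> _ /porbitsP[h ->]; exists root; [apply: set11 | apply: xi_reach].
by apply/subsetP=> _ /set1P->; apply: vert_in.
Qed.

Lemma xi_regular_decomposition : regular_decomposition r (xi r L).
Proof.
have mem_xi i h : (h \in xi r L i) = (vert h != root) && (L h == i).
  by rewrite ffunE inE.
have [M_loopless _ _] := M_plane.
split=> [h|i|h hr ohr|i j|x /porbitsP[h ->] hr].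
- case: (eqVneq (vert h) root) => [hr|hr]; last first.
    by exists (L h); rewrite in_und mem_xi hr eqxx.
  have ohr : vert (opp h) != root by rewrite -hr M_loopless.
  by exists (L (opp h)); rewrite in_und !mem_xi ohr eqxx orbT.
- exact: xi_spanning_tree.
- exists (L h), (L (opp h)); rewrite !mem_xi hr ohr !eqxx; split=> //.
    by have := no_clash h; rewrite inE /inner hr ohr.
  by apply/setP=> k; rewrite inE in_und !mem_xi hr ohr !inE ![k == _]eq_sym.
- rewrite in_und !mem_xi vert_root_edge eqxx vert_opp_root_edge local_opp_root //=.
have p_out i : exists k, k \in xi r L i /\ vert k = vert h.
  by have [k] := xi_out L_loc i hr; exists k.
have [p p_xi] := fin_all_exists p_out.
exists p => [i|].
  apply/setP=> k; rewrite !inE; apply/andP/eqP => [[ki /eqP kh]|->].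
    by have [pi ph] := p_xi i; apply: (xi_fun L_loc ki pi); rewrite kh.
  by have [pi ->] := p_xi i.
split=> [i|]; first by case: (p_xi i).
rewrite (eq_bigr (fun=> 1)) => [|i _]; first by rewrite sum1_card card_ord -(M_regular h).
have [] := p_xi i; rewrite mem_xi => /andP[pr /eqP pi] ph.
(* Consecutive arcs are one clockwise step apart, so the [d] steps make one turn. *)
have <- : cw M (p i) = p (ordS i).
  have [pSi pSh] := p_xi (ordS i); apply: (xi_fun L_loc _ pSi); last by rewrite vert_cw pSh.
  by rewrite mem_xi vert_cw pr local_cw // pi eqxx.
by apply: (@findex_iter_lt _ (cw M) 1); rewrite -/(vert _) M_regular ltnW.
Qed.

End Regular.

Lemma xi_inj L1 L2 : regular_labelling r L1 -> regular_labelling r L2 ->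
  xi r L1 = xi r L2 -> L1 = L2.
Proof.
move=> reg1 reg2 eq_xi.
have loc1 := regular_local reg1; have loc2 := regular_local reg2.
apply/ffunP=> h; case: (eqVneq (vert h) root) => [/root_edgeP[i ->]|hr].
  by rewrite (local_root loc1) (local_root loc2).
have : h \in xi r L1 (L1 h) by rewrite ffunE inE hr eqxx.
by rewrite eq_xi ffunE inE hr => /eqP->.
Qed.

End Labellings.

(** * From regular decompositions to regular labellings *)

Section Decompositions.
Variables (d : nat) (M : cmap) (r : dart M).
Hypotheses (d_gt2 : 2 < d) (M_plane : plane_graph M) (M_regular : regular M d).
Implicit Types (h k : dart M) (i j : 'I_d).
Local Notation opp := (Defs.opp M).
Local Notation root := (root_vertex r).
Local Notation redge := (@root_edge d M r).
Local Notation rface := (@root_face d M r).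

Lemma root_edge_inj : injective redge.
Proof.
move=> i j; rewrite /root_edge => ij; apply: val_inj => /=.
have lt_d (k : 'I_d) : k < #|porbit (cw M)^-1 r| by rewrite porbitV -/(vert r) M_regular.
by rewrite -(findex_iter_lt (lt_d i)) ij findex_iter_lt.
Qed.

Section Surjectivity.
Variable T : {ffun 'I_d -> {set dart M}}.
Hypothesis T_dec : regular_decomposition r T.

Lemma decomposition_vert i h : h \in T i -> vert h != root.
Proof.
case: T_dec => _ T_tree _ _ _ hi; have := root_no_out (T_tree i) hi.
by rewrite inE.
Qed.

Lemma decomposition_opp i h : h \in T i -> opp h \notin T i.
Proof. by case: T_dec => _ T_tree _ _ _; case: (T_tree i) => T_opp _ _ _ _; apply: T_opp. Qed.

Lemma decomposition_reach i h : linked (T i) (vert h) root.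
Proof.
case: T_dec => _ T_tree _ _ _; case: (T_tree i) => _ _ _ T_card T_lk.
have /eqP/cards1P[z /setP/(_ z)] := T_card _ (vert_in h); rewrite !inE eqxx.
by case/andP=> /eqP-> lk; apply: T_lk; rewrite ?vert_in ?set11.
Qed.

(** The two trees of an inner edge contain one arc each; the tree of a root-edge contains its arc
    toward the root-vertex, since no arc of a tree leaves the root. *)
Lemma decomposition_color h : vert h != root -> exists i, forall j, (h \in T j) = (j == i).
Proof.
move=> hr; have [_ _ T_in T_r _] := T_dec.
case: (eqVneq (vert (opp h)) root) => [/root_edgeP|/(T_in h hr)[i [j [ij hi hj /setP T_h]]]].
  case/(_ _ M_regular) => i def_h; exists i => j.
  rewrite -T_r -def_h und_opp in_und; case: (boolP (opp h \in T j)); rewrite ?orbF //.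
  by move/decomposition_vert; rewrite def_h vert_root_edge eqxx.
exists i => k; apply/idP/eqP => [hk|-> //].
have := T_h k; rewrite inE in_und hk !inE => /esym/orP[/eqP//|/eqP def_k].
by have := decomposition_opp hk; rewrite def_k hj.
Qed.

(** The trees do not tell the colors at the root-vertex, which are prescribed there as condition
    (ii) requires. *)
Lemma decomposition_labelling : exists L : {ffun dart M -> 'I_d},
  (forall h j, vert h != root -> (h \in T j) = (j == L h)) /\
  (forall i, L (cw M (redge i)) = i).
Proof.
have L_ex h : exists a : 'I_d,
    (vert h != root -> forall j, (h \in T j) = (j == a)) /\
    (forall i, h = cw M (redge i) -> a = i).
  case: (eqVneq (vert h) root) => [|hr]; last first.
    have [i def_i] := decomposition_color hr; exists i; split=> // j def_h.
    by rewrite def_h vert_cw vert_root_edge eqxx in hr.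
  rewrite -vert_cwV => /(root_edgeP M_regular)[i def_h]; exists i; split=> // j.
  by move/(canLR (permK _)); rewrite def_h => /root_edge_inj.
have [L L_P] := fin_all_exists L_ex.
exists (finfun L); split=> [h j hr|i]; rewrite ffunE; first by have [->] := L_P h.
by have [_] := L_P (cw M (redge i)); apply.
Qed.

Section Labelling.
Variable L : {ffun dart M -> 'I_d}.
Hypothesis L_T : forall h j, vert h != root -> (h \in T j) = (j == L h).
Hypothesis L_r : forall i, L (cw M (redge i)) = i.

Lemma T_label i h : h \in T i -> L h = i.
Proof. by move=> hi; have := L_T i (decomposition_vert hi); rewrite hi => /esym/eqP. Qed.

Lemma decomposition_local : local_labelling r L.
Proof.
have [_ _ _ T_r T_cw] := T_dec.
split=> // [h hr|i]; last first.
  have := L_T i (vert_opp_root_edge r M_plane i).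
  have := T_r i i; rewrite eqxx in_und => /orP[/decomposition_vert|-> /esym/eqP<- //].
  by rewrite vert_root_edge eqxx.
have [p p_T [p_h p_sum]] := T_cw _ (vert_in h) hr.
have p_in i : p i \in T i by have /setP/(_ (p i)) := p_T i; rewrite !inE eqxx => /andP[].
have p_uniq k : vert k = vert h -> k = p (L k).
  move=> kh; have /setP/(_ k) := p_T (L k).
  by rewrite !inE kh eqxx andbT L_T ?kh // eqxx => /esym/eqP.
(* The [d] turns from [p i] to [p (ordS i)] are positive since the colors differ, and they add up to
   [d]. *)
have p_step i : findex (cw M) (p i) (p (ordS i)) = 1.
  pose g i := findex (cw M) (p i) (p (ordS i)).
  have g_gt0 j : 0 < g j.
    rewrite lt0n findex_eq0; apply/eqP => /(congr1 L); rewrite !(T_label (p_in _)).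
    by move/(congr1 val); have := ordS_cases j => /=; lia.
  have : \sum_j (g j - 1) + \sum_(j < d) 1 = \sum_j g j.
    by rewrite -big_split; apply: eq_bigr => j _; rewrite /= subnK.
  rewrite p_sum M_regular sum1_card card_ord -[RHS]add0n => /addIn.
  move/eqP; rewrite sum_nat_eq0 => /forallP/(_ i); rewrite subn_eq0 /= => g1.
  by apply/eqP; rewrite eqn_leq g1 g_gt0.
rewrite {1}(p_uniq h) //.
have pin : p (ordS (L h)) \in porbit (cw M) (p (L h)) by apply/vertP; rewrite !p_h.
by have := findexK pin; rewrite p_step /= => ->; apply: T_label.
Qed.

Lemma decomposition_no_clash : clashes r L = set0.
Proof.
apply/setP=> h; rewrite !inE; apply/andP => -[/andP[hr ohr] /eqP hL].
have [_ _ T_in _ _] := T_dec; have [i [j [/eqP ij hi oj _]]] := T_in h hr ohr.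
by case: ij; rewrite -(T_label hi) -(T_label oj).
Qed.

Lemma descents_eq0 h k : descents L (face h) = 0 -> k \in face h -> L k = L h.
Proof.
move=> desc0; apply: porbit_const => z hz; apply/esym/eqP; rewrite -cdist_eq0.
have /eqP := sum_cdist (fcw M) L h; rewrite [#|_|]desc0 muln0 sum_nat_eq0.
by move/forallP/(_ z); rewrite hz.
Qed.

Lemma decomposition_fun i : {in T i &, forall h k, vert h = vert k -> h = k}.
Proof.
move=> h k hi ki hk; have [_ _ _ _ T_cw] := T_dec.
have [p p_T _] := T_cw _ (vert_in k) (decomposition_vert ki).
have /setP T_i := p_T i; have := T_i h; have := T_i k.
by rewrite !inE hi ki hk eqxx => /esym/eqP-> /esym/eqP->.
Qed.

(* The boundary of a monochromatic non-root face would be a directed cycle. *)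
Lemma descents_gt0 f : f \in faces M -> f \notin root_faces d r -> 0 < descents L f.
Proof.
move=> fF f_nr; have f_vert := nonroot_face_vert M_regular fF (elimT (root_facesPn _ _ _) f_nr).
rewrite lt0n; apply/eqP; have [h def_f] := porbitsP fF.
rewrite {1}def_f => desc0; have hf : h \in f by rewrite def_f porbit_id.
have f_T k : k \in f -> k \in T (L h).
  move=> kf; rewrite L_T ?f_vert // (descents_eq0 desc0) //.
  by rewrite /face -def_f.
(* At a vertex of the face, the only arc [k] of the tree follows the boundary, and its head is the
   origin of the corner [fcw^-1 k]; hence the path to the root-vertex stays on the face. *)
have [k kf] : exists2 k, k \in f & vert k = root.
  have /connectP[p pp ->] := decomposition_reach (L h) h.
  elim: p {1 3 4}h hf pp {desc0} => [|z p IH] k kf /=; first by exists k.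
  case/andP=> /adjP[k' k'T [k'k <-]]; rewrite (decomposition_fun k'T (f_T k kf) k'k).
  rewrite -(vert_cw (opp k)) -fcwVE; apply: IH.
  by rewrite def_f -eq_porbit_mem porbit_stepV eq_porbit_mem -def_f.
by move/eqP; apply/negP/f_vert.
Qed.

Lemma decomposition_descents f : f \in faces M ->
  descents L f = (f \notin root_faces d r).
Proof.
(* The excess over the expected number of descents. There are no clashes and at most [d] root-faces,
   so [labelling_count] makes the total excess at most 0. *)
pose g f := if f \in root_faces d r then descents L f else descents L f - 1.
have := labelling_count d_gt2 M_plane M_regular decomposition_local.
rewrite decomposition_no_clash cards0 addn0.
have -> : \sum_(f in faces M) descents L f =
    \sum_(f in faces M) g f + #|faces M :\: root_faces d r|.
  rewrite -sum1_card [X in _ + X](eq_bigl (fun f => (f \in faces M) && (f \notin root_faces d r))).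
    rewrite big_mkcondr /= -big_split /=; apply: eq_bigr => h hF; rewrite /g.
    by case: ifP => h_r; rewrite ?addn0 // subnK // descents_gt0 // h_r.
  by move=> h; rewrite inE andbC.
have rfF := root_faces_sub d r.
have rf_d : #|root_faces d r| <= d by rewrite -[leqRHS]card_ord leq_imset_card.
have := subset_leq_card rfF; rewrite cardsD (setIidPr rfF).
move: #|faces M| #|root_faces d r| rf_d => F R; set S := \sum_(f in _) g f.
move=> le_Rd le_RF count fF; have /eqP : S = 0 by lia.
rewrite sum_nat_eq0 => /forallP/(_ f); rewrite fF /g /=.
have := @descents_gt0 f fF; case: (f \in _) => /= [_ /eqP //|/(_ isT)].
by case: (descents L f) => [|[]].
Qed.

Lemma decomposition_regular : regular_labelling r L.
Proof.
have [Lcw _ _] := decomposition_local.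
split=> // [h|i h|f fF f_nr].
- case/(root_edgeP M_regular) => i ->.
  by rewrite L_r (local_root M_regular decomposition_local) ordSK.
- rewrite /root_face => hi; rewrite -[RHS]L_r; apply: descents_eq0 hi.
  rewrite decomposition_descents ?porbit_mem // (imset_f (root_face r)) //.
by have := decomposition_descents fF; rewrite (introT (root_facesPn _ _ _) f_nr).
Qed.

Lemma xi_decomposition : xi r L = T.
Proof.
apply/ffunP=> i; apply/setP=> h; rewrite ffunE inE.
case: (boolP (vert h != root)) => [hr|/negP hr]; first by rewrite L_T // eq_sym.
by apply/esym/negP => /decomposition_vert.
Qed.

End Labelling.

Lemma xi_surj : exists2 L, regular_labelling r L & xi r L = T.
Proof.
have [L [L_T L_r]] := decomposition_labelling.
by exists L; [apply: decomposition_regular | apply: xi_decomposition].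
Qed.

End Surjectivity.
End Decompositions.

(** * The dual map *)

Section Dual.
Variable M : cmap.
Implicit Types h k : dart M.
Local Notation opp := (Defs.opp M).

Lemma fcw_dualE (h : dart (dual M)) : fcw (dual M) h = opp (cw M (opp h)).
Proof. by rewrite -fcwVE; apply: (@fcwE (dual M)). Qed.

Lemma iter_fcw_dual m (h : dart (dual M)) :
  iter m (fcw (dual M)) h = opp (iter m (cw M) (opp h)).
Proof.
elim: m => [|m IH] /=; first by rewrite oppK.
by rewrite IH fcw_dualE oppK.
Qed.

(** A face of the dual is a vertex of [M] whose corners are indexed by the opposite darts. *)
Lemma mem_dual_face (h k : dart (dual M)) : (k \in face h) = (opp k \in vert (opp h)).
Proof.
apply/idP/idP => [/porbit_iterP[m _ ->]|/porbit_iterP[m _ def_k]].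
  by rewrite (iter_fcw_dual m h) oppK mem_porbit_iter.
by rewrite -[k]oppK def_k -iter_fcw_dual; apply: (mem_porbit_iter (fcw (dual M))).
Qed.

Lemma dual_face_eq (h k : dart (dual M)) :
  vert (opp h) = vert (opp k) -> face h = face k.
Proof. by move/vertP; rewrite -mem_dual_face => /(@faceP (dual M)). Qed.

Lemma card_dual_faces : #|faces (dual M)| = #|vertices M|.
Proof.
pose g (v : {set dart M}) := [set opp h | h in v].
have gE h : g (vert (opp h)) = @face (dual M) h.
  apply/setP=> k; rewrite (mem_dual_face h k); apply/imsetP/idP => [[k' k'h ->]|kh].
    by rewrite oppK.
  by exists (opp k); rewrite ?oppK.
have -> : faces (dual M) = g @: vertices M.
  apply/setP=> f; apply/imsetP/imsetP => [[h _ ->]|[v /porbitsP[h ->] ->]].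
    by exists (vert (opp h)); rewrite ?vert_in ?gE.
  by exists (opp h) => //; rewrite -[h in LHS]oppK; apply: gE.
by rewrite card_imset //; apply: imset_inj; apply: perm_inj.
Qed.

Lemma dual_planar : planar M -> planar (dual M).
Proof. by rewrite /planar card_dual_faces addnC. Qed.

Lemma dual_dart_connected : dart_connected M -> dart_connected (dual M).
Proof.
move=> con c c_cw c_opp; apply: con => // h.
by rewrite -[RHS]c_opp -[Defs.opp (dual M) h]/(opp h) -fcw_cw; apply/esym/c_cw.
Qed.

End Dual.

(** * From regular labellings to Schnyder decompositions *)

Section Schnyder.
Variables (d : nat) (M : cmap) (r : dart M).
Hypotheses (d_gt2 : 2 < d) (M_plane : plane_graph M) (M_regular : regular M d).
Implicit Types (h k : dart M) (i j : 'I_d).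
Local Notation opp := (Defs.opp M).
Local Notation root := (root_vertex r).
Local Notation redge := (@root_edge d M r).
Local Notation rface := (@root_face d M r).
Local Notation rfaces := (@root_faces d M r).

Lemma externalE (h : dart (dual M)) : external (dual_root r) h = ~~ inner r h.
Proof.
rewrite /external !(mem_dual_face (dual_root r)) /dual_root !oppK negb_and !negbK orbC.
by congr (_ || _); apply/idP/eqP => /vertP.
Qed.

Section Psi.
Variable L : {ffun dart M -> 'I_d}.
Hypothesis L_reg : regular_labelling r L.
Let L_loc := regular_local L_reg.
Let ok h := no_clash d_gt2 M_plane M_regular L_reg h.

Lemma psi_nonroot i h : h \in psi L i -> face h \notin rfaces.
Proof.
rewrite ffunE inE => hi; apply/root_facesP => -[m hm]; move: hi.
have h_m : h \in rface m by apply/faceP.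
have h_m' : (fcw M)^-1%g h \in rface m.
  by rewrite /root_face -eq_porbit_mem porbit_stepV eq_porbit_mem.
by rewrite !(label_root_face L_reg (i := m)) // crossedaa.
Qed.

(** For the dual arc [h], [cw h] and [opp h] are the corners on both sides of its arrival. Going up
    from one to the other within [i+2, ..., i-1] is the form of condition (iii) that [between_color]
    turns into positions. *)
Lemma psi_in i h : h \in psi L i -> 2 <= cdist i (L (cw M h)) <= cdist i (L (opp h)).
Proof.
move=> hi; have hin := psi_inner M_plane M_regular L_loc hi.
have := in_psi_inner i L_loc hin (ok h); rewrite hi => /esym.
case/andP: hin => hr _; rewrite (local_cw L_loc) //.
by move: (L h) (L (opp h)) => a b; cyclic_lia.
Qed.

Lemma in_und_psi i h : inner r h -> (h \in und (psi L i)) = (i \notin [set L h; L (opp h)]).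
Proof.
move=> hin; rewrite in_und !inE ![i == _]eq_sym.
have := edge_colors d_gt2 i L_loc hin (ok h).
by case: (_ \in _); case: (_ \in _); case: (_ == _); case: (_ == _).
Qed.

Lemma psi_fun i : {in psi L i &, forall h k, face h = face k -> h = k}.
Proof.
move=> h k hi ki hk; have [k' _ [_ k_uniq]] := psi_face L_reg i (psi_nonroot ki).
by apply: etrans (k_uniq h hi hk) (esym (k_uniq k ki erefl)).
Qed.

Lemma psi_reach i h :
  exists2 f, f \in rfaces & @linked (dual M) (psi L i) (face h) f.
Proof.
have [_ /connected_dart/dual_dart_connected con /dual_planar planar] := M_plane.
(* In the dual the two families exchange their roles, and the arcs of [xi] are reversed because the
   corners of a dual face are opposite darts. *)
pose E2 := [set k | opp k \in xi r L i].
have disj := xi_psi_disj d_gt2 M_plane M_regular L_reg.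
have antisym_xi := xi_antisym d_gt2 M_plane M_regular L_reg.
have antisym_psi := psi_antisym d_gt2 M_plane M_regular L_reg.
apply: (@reach (dual M) (psi L i) E2 rfaces con planar).
- by move=> k k_nr; have [k' k'i [k'k _]] := psi_face L_reg i k_nr; exists k'.
- move=> k k_nr; have kr : vert (opp k) != root.
    apply/eqP => /(root_edgeP M_regular)[j /(canRL (@oppK M)) def_k].
    suff k_r : @face M k \in rfaces by apply: (elimN idP (k_nr k (porbit_id _ _))) k_r.
    apply/root_facesP; exists j; apply/faceP; rewrite def_k; apply: mem_root_face_opp.
  have [k' k'i k'k] := xi_out L_loc i kr.
  by exists (opp k'); [rewrite inE oppK | apply: dual_face_eq; rewrite oppK].
- move=> k ki; rewrite inE; apply/negP => /disj/andP[_].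
  by rewrite oppK ki.
- move=> k; rewrite !in_setU !inE negb_or => /orP[ki|ki].
    rewrite antisym_psi // oppK; apply/negP => /disj/andP[].
    by rewrite ki.
  by case/andP: (disj _ _ ki) => -> _; apply: antisym_xi.
- exists (cw M r); apply: (introT (@root_facesP d M r (face (cw M r)))).
  by exists (Ordinal (ltnW (ltnW d_gt2))).
- move=> c c_opp k1 k2.
  (* All root-faces are incident to the root-vertex, which is the face of [opp r] in the dual. *)
  have c_root k : face k \in rfaces -> c (@face (dual M) k) = c (@face (dual M) (opp r)).
    case/root_facesP => j kj; have def_k : face (opp (redge j)) = face k.
      by rewrite kj; apply/faceP; apply: mem_root_face_opp.
    rewrite (@vert_face_const (dual M) c (opp (redge j)) k) //; last first.
      by move=> z zj; apply: c_opp; rewrite [vert _]zj [vert _]def_k kj; apply: imset_f.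
    by congr c; apply: dual_face_eq; rewrite !oppK vert_root_edge.
  by move=> /c_root-> /c_root->.
Qed.

Definition forest_vertices i := faces M :\: [set rface i; rface (ordS i)].
Definition forest_roots i := [set rface j | j : 'I_d & (j != i) && (j != ordS i)].

(** The colors in the root-faces [i] and [i+1] are at distance 0 and 1 from [i], below the bound 2
    of [psi_in]. *)
Lemma psi_vertices i h : h \in psi L i ->
  face h \in forest_vertices i /\ face (opp h) \in forest_vertices i.
Proof.
move=> hi; have h_nr := psi_nonroot hi; split; rewrite inE porbit_mem andbT !inE.
  apply/norP; split; apply: contraNneq h_nr => ->; exact: imset_f.
have := psi_in hi; apply: contraTN.
suff root_color m : face (opp h) = rface m -> L (opp h) = m.
  by case/orP=> /eqP/root_color->; rewrite ?cdistaa ?andbF //;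
     apply/negP => /andP[h1 h2]; move: (leq_trans h1 h2); cyclic_lia.
by move=> hm; apply: (label_root_face L_reg); apply/faceP.
Qed.

Lemma psi_forest i :
  @rooted_forest (dual M) (psi L i) (forest_vertices i) (forest_roots i).
Proof.
have R_rf f : f \in forest_roots i -> f \in rfaces.
  by case/imsetP=> j _ ->; apply: imset_f.
apply: (@functional_rooted_forest (dual M)).
- exact: psi_fun.
- exact: (psi_antisym d_gt2 M_plane M_regular L_reg).
- by move=> h /psi_nonroot; apply: contra => /R_rf.
- exact: psi_vertices.
- move=> x; rewrite inE => /andP[x_S /porbitsP[h def_x]].
  have [y /root_facesP[m def_y] lk] := psi_reach i h; rewrite -[face h]def_x in lk.
  (* Arcs of [psi L i] stay in [forest_vertices i], so the root-face reached is neither the [i]-th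
     nor the next one. *)
  exists y => //; have yS : y \in forest_vertices i.
    have xS : x \in forest_vertices i by rewrite inE x_S def_x porbit_mem.
    case/connectP: lk => p pp ->; elim: p x xS pp {x_S def_x} => //= z p IH x _.
    case/andP=> /(@adjP (dual M))[k /psi_vertices[_ kS] [_ <-]] pp.
    by apply: IH pp.
  rewrite def_y; apply/imsetP; exists m => //; rewrite inE.
  move: yS; rewrite !inE def_y => /andP[/norP[h1 h2] _].
  by apply/andP; split; [apply: contraNneq h1 | apply: contraNneq h2] => ->.
apply/subsetP=> _ /imsetP[j + ->]; rewrite !inE root_face_in andbT => /andP[h1 h2].
by rewrite !(inj_eq (root_face_inj L_reg)) negb_or h1.
Qed.

(** By [in_und_psi], the inner edges missing from the forest [i] are those with an arc of color [i];
    among the root-edges, only the [i]-th is missing from the completed forest. The orientation is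
    recovered by [orient_toward_und]. *)
Lemma chi_psi : chi r (psi L) = xi r L.
Proof.
have [_ _ _ xi_r _] := xi_regular_decomposition d_gt2 M_plane M_regular L_reg.
apply/ffunP=> i; rewrite ffunE.
have -> : ~: completed_forest (dual_root r) (psi L) i = und (xi r L i).
  have sym h : ((h : dart (dual M)) \in completed_forest (dual_root r) (psi L) i) =
      (h \in und (psi L i)) || ~~ inner r h && (h \notin edge (redge i)).
    rewrite in_setU in_set externalE ext_dart_dual.
    by have -> : @edge (dual M) (opp (redge i)) = edge (redge i) by apply: edge_opp.
  have root_case j : (redge j \notin completed_forest (dual_root r) (psi L) i)
      = (redge j \in und (xi r L i)).
    rewrite sym xi_r in_und !psi_root // inner_root_edge /= negbK !inE.
    rewrite (inj_eq (root_edge_inj M_regular)) eq_sym orbC.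
    case: eqP => //= def_j; have := vert_opp_root_edge r M_plane i.
    by rewrite -def_j vert_root_edge eqxx.
  apply/setP=> h; rewrite in_setC; elim/(inner_ind M_regular (r := r)): h => [h hin|j|j].
  - rewrite sym hin orbF in_und_psi // negbK in_und !ffunE !inE.
    by case/andP: hin => -> ->; rewrite ![i == _]eq_sym.
  - exact: root_case.
  rewrite und_opp -root_case !sym und_opp inner_opp.
  by rewrite !mem_edge edge_opp.
apply: (@orient_toward_und M (xi r L i) (vertices M)).
  exact: xi_fun.
exact: (xi_spanning_tree d_gt2 M_plane M_regular L_reg).
Qed.

End Psi.
End Schnyder.

(** * Colorings of an orbit *)

Section OrbitColoring.
Variables (d : nat) (T : finType) (s : {perm T}) (x : T).
Implicit Types (h k a b : T) (i j : 'I_d).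
Local Notation orb := (porbit s x).
Local Notation n := #|orb|.

(** With positions counted from [y], the way from [a] to [b] is the difference of their positions,
    plus [n] if [b] comes before [a]. *)
Lemma findex_add y a b : y \in orb -> a \in orb -> b \in orb ->
  findex s a b + findex s y a
    = findex s y b + n * (findex s y b < findex s y a).
Proof.
move=> /eq_porbitP yx /eq_porbitP ax bx; have /eq_porbitP b'x := bx.
have ya : a \in porbit s y by apply/eq_porbitP; rewrite ax yx.
have yb : b \in porbit s y by apply/eq_porbitP; rewrite b'x yx.
have ab : b \in porbit s a by apply/eq_porbitP; rewrite b'x ax.
have def_b : iter (findex s a b + findex s y a) s y = b.
  by rewrite iterD (findexK ya) (findexK ab).
have lt_a := findex_lt ya; have lt_b := findex_lt yb; have lt_ab := findex_lt ab.
rewrite yx in lt_a lt_b; rewrite ax in lt_ab.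
set u := findex s a b + _ in def_b *.
case: (ltnP u n) => u_n.
  have -> : findex s y b = u by rewrite -def_b findex_iter_lt ?yx.
  by rewrite ltnNge leq_addl muln0 addn0.
have def_b' : findex s y b = u - n.
  rewrite -def_b -{1}(subnK u_n) iterD -[in iter n]yx iter_porbit findex_iter_lt // yx.
  by rewrite /u; lia.
rewrite def_b'; have -> : u - n < findex s y a by rewrite /u; lia.
by rewrite muln1 subnK.
Qed.

(** The differences of positions cancel, leaving [n] times the number of turns made by [p]. *)
Lemma sum_findex (p : 'I_d -> T) y : y \in orb -> (forall i, p i \in orb) ->
  \sum_i findex s (p i) (p (ordS i)) =
    n * \sum_i (findex s y (p (ordS i)) < findex s y (p i)).
Proof.
move=> yx px; apply: (@addIn (\sum_i findex s y (p i))).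
rewrite -big_split big_distrr /= [X in _ = _ + X](reindex_inj (@ordS_inj d)).
rewrite -big_split; apply: eq_bigr => i _ /=.
by rewrite findex_add // addnC.
Qed.

Section Colored.
Variables (l : T -> 'I_d) (p : 'I_d -> T).
Hypotheses (d_gt2 : 2 < d) (p_orb : forall i, p i \in orb).
Hypothesis lP : forall h, h \in orb ->
  forall j, crossed j (l ((s^-1)%g h)) (l h) = (h == p j).

Let orb_iter m i : iter m s (p i) \in orb.
Proof. by rewrite -eq_porbit_mem porbit_iter eq_porbit_mem. Qed.

Let card_p i : #|porbit s (p i)| = n.
Proof. by have /eq_porbitP-> := p_orb i. Qed.

Let p_in i j : p j \in porbit s (p i).
Proof. by apply/eq_porbitP; rewrite !(elimT (eq_porbitP _ _ _) (p_orb _)). Qed.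

Let lP_iter m i j :
  crossed j (l (iter m s (p i))) (l (iter m.+1 s (p i))) = (iter m.+1 s (p i) == p j).
Proof. by rewrite -(lP (orb_iter m.+1 i)) /= permK. Qed.

(** At [p i] the color crosses [i] but not [i+1], so it becomes [i+1]; any later change crosses
    [i+1], which happens only at [p (ordS i)]. *)
Lemma color_between i m : m < findex s (p i) (p (ordS i)) ->
  l (iter m s (p i)) = ordS i.
Proof.
elim: m => [|m IH] lt_m; first rewrite [iter 0 _ _]/=.
  have pS : (p i == p (ordS i)) = false by apply/negbTE; rewrite -(findex_eq0 s) -lt0n.
  have := lP (p_orb i) i; have := lP (p_orb i) (ordS i); rewrite eqxx pS /=.
  move: (l _) (l _) => a b h1 h2; apply: ord_inj; move: h1 h2; cyclic_lia.
have := lP_iter m i (ordS i); rewrite IH ?(ltnW lt_m) // (negPf (iter_neq (p_in _ _) lt_m)).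
move: (l _) => a h1; apply: ord_inj; move: h1; cyclic_lia.
Qed.

(** The stretches from [p i] to [p (ordS i)] have distinct colors, so the sum is at most [n], and it
    is a multiple of [n]. If it were 0, all the [p i] would coincide and a single step would cross
    [d] colors instead of at most [d-1]. *)
Lemma sum_findex_colored : \sum_i findex s (p i) (p (ordS i)) = n.
Proof.
have le_n : \sum_i findex s (p i) (p (ordS i)) <= n.
  rewrite -[leqRHS]sum1_card (partition_big l predT) //=.
  rewrite [leqRHS](reindex_inj (@ordS_inj d)) /=; apply: leq_sum => i _.
  rewrite sum1dep_card; set m := findex _ _ _.
  have inj : injective (fun u : 'I_m => iter u s (p i)).
    have m_n : m < #|porbit s (p i)| := findex_lt (p_in _ _).
    move=> u v uv; apply: val_inj => /=.
    rewrite -(findex_iter_lt (ltn_trans (ltn_ord u) m_n)) uv.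
    by rewrite findex_iter_lt // (ltn_trans (ltn_ord v)).
  rewrite -[m in leqLHS]card_ord -(card_imset _ inj); apply: subset_leq_card.
  by apply/subsetP=> _ /imsetP[u _ ->]; rewrite inE orb_iter color_between ?eqxx.
rewrite (sum_findex (p_orb (Ordinal (ltnW (ltnW d_gt2))))) // in le_n *.
set y := p _ in le_n *; set w := \sum_i _ in le_n *.
have n_gt0 : 0 < n by rewrite lt0n card_porbit_neq0.
have w_le1 : w <= 1 by rewrite -(leq_pmul2l n_gt0) muln1.
suff w_gt0 : 0 < w by rewrite (_ : w = 1) ?muln1 //; apply/eqP; rewrite eqn_leq w_le1.
rewrite lt0n; apply/eqP => w0.
have : \sum_i findex s (p i) (p (ordS i)) = n * w by apply: sum_findex; rewrite ?p_orb.
rewrite w0 muln0 => /eqP; rewrite sum_nat_eq0 => /forallP p_eq.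
have p_all i : p i = y.
  rewrite -(iter_ordS_cdist (Ordinal (ltnW (ltnW d_gt2))) i).
  elim: (cdist _ i) => //= m <-; apply/esym/eqP; rewrite -(findex_eq0 s).
  exact: (implyP (p_eq _)).
have := cdist_lt (l ((s^-1)%g y)) (l y); rewrite -card_crossed.
rewrite (_ : [set j | _] = setT) ?cardsT ?card_ord ?ltnn //.
by apply/setP=> j; rewrite !inE lP ?p_all ?eqxx // -(p_all (Ordinal (ltnW (ltnW d_gt2)))).
Qed.

Definition between a k b :=
  0 < findex s a k < (if a == b then n else findex s a b).

(** Counted from [j], a color passes from below 2 to at least 2 only by crossing [j+1], and back
    only by crossing [j-1]. If the two bounds differ, it thus stays below 2 from [p (ord_pred j)]
    until [p (ordS j)] is met again. *)
Lemma between_color j k : k \in orb ->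
  2 <= cdist j (l ((s^-1)%g k)) <= cdist j (l k) ->
  between (p (ordS j)) k (p (ord_pred j)).
Proof.
move=> kx lk; have ak : k \in porbit s (p (ordS j)).
  by apply/eq_porbitP; rewrite (eq_porbitP _ _ _ kx) (eq_porbitP _ _ _ (p_orb _)).
rewrite /between lt0n findex_eq0; apply/andP; split.
  apply/eqP => ka; have := lP kx (ordS j); rewrite ka eqxx; move: lk.
  move: (l _) (l _) => v u; have := crossed_succ_cases j u v (ltnW d_gt2).
  by move: (crossed _ _ _) (cdist j u) (cdist j v) => c a b; lia.
case: (eqVneq (p (ordS j)) (p (ord_pred j))) => [_|ab].
  by rewrite -(card_p (ordS j)) findex_lt.
set m := findex _ _ (p (ord_pred j)); rewrite ltnNge; apply/negP => le_m.
suff low q : m + q < n -> cdist j (l (iter (m + q) s (p (ordS j)))) <= 1.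
  have := low (findex s (p (ordS j)) k - m); rewrite subnKC // findexK //.
  rewrite -(card_p (ordS j)) findex_lt // => /(_ isT).
  by case/andP: lk => h1 h2; rewrite leqNgt (leq_trans h1 h2).
elim: q => [|q IH] lt_n.
  rewrite addn0 /m findexK //.
  have := lP (p_orb (ord_pred j)) (ordS j); have := lP (p_orb (ord_pred j)) (ord_pred j).
  rewrite eqxx eq_sym (negPf ab); move: (l _) (l _) => v u.
  rewrite crossed_pred; have := crossed_succ_cases j u v (ltnW d_gt2).
  by move: (crossed _ _ _) (cdist j u) (cdist j v) => c a b; lia.
rewrite addnS in lt_n *; have := lP_iter (m + q) (ordS j) (ordS j).
have := lP_iter (m + q) (ordS j) (ord_pred j).
rewrite (negPf (iter_neq0 _)) ?card_p //.
have -> : (iter (m + q).+1 s (p (ordS j)) == p (ord_pred j)) = false.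
  apply/eqP => def_b; have := findex_iter_lt (s := s) (m := (m + q).+1) (x := p (ordS j)).
  by rewrite card_p def_b -/m => /(_ lt_n); lia.
move: (IH (ltnW lt_n)); move: (l _) (l _) => v u.
rewrite crossed_pred; have := crossed_succ_cases j u v (ltnW d_gt2).
by move: (crossed _ _ _) (cdist j u) (cdist j v) => c a b; lia.
Qed.

(** The bound [d-2] prevents the step at [p (ordS j)] from going from color [j+1] all the way up to
    [j]. After this step the color counted from [j] is at least 2, until [j-1] is crossed. *)
Lemma color_of_between j k : k \in orb ->
  cdist (l ((s^-1)%g (p (ordS j)))) (l (p (ordS j))) <= d - 2 ->
  between (p (ordS j)) k (p (ord_pred j)) ->
  2 <= cdist j (l ((s^-1)%g k)) <= cdist j (l k).
Proof.
move=> kx le_d; have ak : k \in porbit s (p (ordS j)).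
  by apply/eq_porbitP; rewrite (eq_porbitP _ _ _ kx) (eq_porbitP _ _ _ (p_orb _)).
rewrite /between; set B := if _ then _ else _ => /andP[k_gt0 k_B].
have neq_b m : 0 < m < B -> (iter m s (p (ordS j)) == p (ord_pred j)) = false.
  rewrite /B; case: eqVneq => [<-|ab] /andP[m_gt0 m_B]; apply: negbTE.
    by apply: iter_neq0; rewrite m_gt0 card_p.
  exact: iter_neq.
have high m : m < B -> 2 <= cdist j (l (iter m s (p (ordS j)))).
  elim: m => [|m IH] m_B /=.
    move: le_d; have := lP (p_orb (ordS j)) (ordS j); rewrite eqxx.
    have := lP (p_orb (ordS j)) (ord_pred j).
    move: (l _) (l _) => v u; rewrite crossed_pred.
    have := crossed_succ_cases j u v (ltnW d_gt2).
    have := cdist_lt j u; have := cdist_lt j v.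
    have -> : cdist u v = cdist (cshift j u) (cshift j v) by rewrite cdist_cshift.
    have := cdist_cases (cshift j u) (cshift j v); move: (cdist (cshift j u) _) => w /=.
    by move: (crossed _ _ _) (cdist j u) (cdist j v) (_ == _) d_gt2 => c a b e; lia.
  move: (IH (ltnW m_B)); have := lP_iter m (ordS j) (ord_pred j).
  by rewrite neq_b //=; move: (l _) (l _) => v u; rewrite crossed_pred; lia.
have := findexK ak; move: k_gt0 k_B; case: (findex s _ k) => // m _ m_B <-.
rewrite /= permK; move: (high m (ltnW m_B)); have := lP_iter m (ordS j) (ord_pred j).
by rewrite neq_b //=; move: (l _) (l _) => v u; rewrite crossed_pred; lia.
Qed.

End Colored.

(* Cut the orbit at [p e], where [p e] differs from its predecessor.  The color
   of [k] is the successor of the last [i], starting from [e], such that [p i] is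
   not after [k]. *)
Lemma orbit_coloring (p : 'I_d -> T) : (forall i, p i \in orb) ->
  \sum_i findex s (p i) (p (ordS i)) = n ->
  exists l : T -> 'I_d, forall h, h \in orb ->
    forall j, crossed j (l ((s^-1)%g h)) (l h) = (h == p j).
Proof.
move=> p_orb p_sum; have n_gt0 : 0 < n by rewrite lt0n card_porbit_neq0.
have [i0 g_gt0] : exists i, 0 < findex s (p i) (p (ordS i)).
  apply/existsP; apply: contraTT n_gt0 => /existsPn g0; rewrite -p_sum -leqNgt leqn0.
  by rewrite sum_nat_eq0; apply/forallP => i; rewrite /= -leqn0 leqNgt g0.
pose e := ordS i0; pose pos k := findex s (p e) k.
have pos0 k : (pos k == 0) = (k == p e) by rewrite findex_eq0 eq_sym.
have e_orb h : h \in orb -> h \in porbit s (p e).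
  by move=> hx; apply/eq_porbitP; rewrite (eq_porbitP _ _ _ hx) (eq_porbitP _ _ _ (p_orb e)).
have card_e : #|porbit s (p e)| = n by rewrite (eq_porbitP _ _ _ (p_orb e)).
have pos_lt h : h \in orb -> pos h < n by move/e_orb/findex_lt; rewrite card_e.
have pos_inj h k : h \in orb -> k \in orb -> pos h = pos k -> h = k.
  by move=> /e_orb/findexK + /e_orb/findexK; rewrite -/(pos h) -/(pos k) => eh ek hk;
     rewrite -eh -ek hk.
have pos_i0 : 0 < pos (p i0).
  by rewrite lt0n pos0; apply: contraTneq g_gt0 => ->; rewrite -/e findex0.
(* By [sum_findex], the positions of the [p i] drop only once in a cyclic turn of the colors, and
   they do so from [i0] to [e]. *)
have pos_step i : i != i0 -> pos (p i) <= pos (p (ordS i)).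
  move=> i_i0; rewrite leqNgt; apply/negP => wrap.
  move: p_sum; rewrite (sum_findex (p_orb e)) // => /eqP.
  rewrite -[X in _ == X]muln1 eqn_pmul2l // (bigD1 i0) //= (bigD1 i) //=.
  by rewrite -![findex s (p e) _]/(pos _) wrap (eqP (_ : pos (p e) == 0)) ?pos0 // pos_i0.
have dist_i0 : cdist e i0 = d.-1 by rewrite /e; cyclic_lia.
have pos_iter m1 m2 : m1 <= m2 -> m2 < d ->
    pos (p (iter m1 (@ordS d) e)) <= pos (p (iter m2 (@ordS d) e)).
  elim: m2 => [|m2 IH]; first by rewrite leqn0 => /eqP->.
  rewrite leq_eqVlt => /orP[/eqP-> //|le_m lt_m]; apply: leq_trans (IH le_m (ltnW lt_m)) _.
  rewrite /=; apply: pos_step; apply/eqP => def_i0.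
  by have := cdist_iter_ordS e (ltnW lt_m); rewrite def_i0 dist_i0; lia.
have pos_mono i j : cdist e i <= cdist e j -> pos (p i) <= pos (p j).
  by move=> ij; rewrite -(iter_ordS_cdist e i) -(iter_ordS_cdist e j) pos_iter ?cdist_lt.
pose w k := [arg max_(i > e | pos (p i) <= pos k) cdist e i].
have wP k i : (pos (p i) <= pos k) = (cdist e i <= cdist e (w k)).
  rewrite /w; case: arg_maxnP => [|j pj j_max].
    by rewrite (eqP (_ : pos (p e) == 0)) ?pos0.
  by apply/idP/idP => [/j_max //|/pos_mono ij]; apply: leq_trans pj.
exists (fun k => ordS (w k)) => h hx j.
have h'x : (s^-1)%g h \in orb by rewrite -eq_porbit_mem porbit_stepV eq_porbit_mem.
have hj : (h == p j) = (pos h == pos (p j)).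
  by apply/eqP/eqP => [-> //|]; apply: pos_inj.
have h_iter := findexK (e_orb _ hx); rewrite -/(pos h) in h_iter.
rewrite hj; case def_t : (pos h) h_iter => [|t] /= h_iter.
  (* At the cut, the predecessor of [h] is the last element of the orbit, whose color is
     [ordS i0 = e]. *)
  have w' : w ((s^-1)%g h) = i0.
    apply: (cdistK (a := e)); apply/eqP; rewrite eqn_leq -wP {1}dist_i0.
    rewrite -ltnS prednK ?cdist_lt ?(leq_ltn_trans _ (ltn_ord e)) //=.
    have h'_iter : (s^-1)%g h = iter n.-1 s (p e).
      apply: (@perm_inj _ s); rewrite permKV -iterS prednK // -card_e iter_porbit.
      by apply/eqP; rewrite -pos0 def_t.
    by rewrite h'_iter /pos findex_iter_lt ?card_e ?prednK // -ltnS prednK // pos_lt.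
  rewrite w' -/e eq_sym -leqn0 -def_t wP.
  have : cdist e (w h) < d.-1.
    rewrite -dist_i0 ltnNge -wP def_t -ltnNge; exact: pos_i0.
  by move: (w h) => a; move=> lt_a; apply/idP/idP; move: lt_a; cyclic_lia.
have h'_pos : pos ((s^-1)%g h) = t.
  by rewrite -h_iter permK /pos findex_iter_lt // card_e -ltnS -def_t ltnW // ltnS pos_lt.
have w_le : cdist e (w ((s^-1)%g h)) <= cdist e (w h).
  by rewrite -wP def_t; apply: leqW; rewrite -h'_pos wP.
rewrite (crossed_ordS_ordS _ w_le) -wP ltnNge -wP h'_pos def_t.
by rewrite -ltnNge eqn_leq andbC.
Qed.

End OrbitColoring.

(** * The forests of a regular labelling form a Schnyder decomposition *)

Section SchnyderPsi.
Variables (d : nat) (M : cmap) (r : dart M).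
Hypotheses (d_gt2 : 2 < d) (M_plane : plane_graph M) (M_regular : regular M d).
Implicit Types (h k : dart M) (i j : 'I_d).
Local Notation opp := (Defs.opp M).
Local Notation root := (root_vertex r).
Local Notation redge := (@root_edge d M r).
Local Notation rface := (@root_face d M r).
Local Notation rfaces := (@root_faces d M r).

Lemma ext_forest_vertices i : vertices (dual M) :\:
  [set ext_vertex (dual_root r) i; ext_vertex (dual_root r) (ordS i)]
    = forest_vertices r i.
Proof. by rewrite !ext_vertex_dual. Qed.

Lemma ext_forest_roots i :
  [set ext_vertex (dual_root r) j | j : 'I_d & (j != i) && (j != ordS i)]
    = forest_roots r i.
Proof. by apply: eq_imset => j; rewrite ext_vertex_dual. Qed.

Lemma psi_schnyder (L : {ffun dart M -> 'I_d}) : regular_labelling r L ->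
  schnyder_decomposition (dual_root r) (psi L).
Proof.
move=> L_reg; have L_loc := regular_local L_reg.
have ok h := no_clash d_gt2 M_plane M_regular L_reg h.
have psi_card h : inner r h -> #|[set i | h \in und (psi L i)]| = d - 2.
  move=> hin; rewrite (_ : [set i | _] = ~: [set L h; L (opp h)]).
    rewrite cardsCs setCK card_ord cards2.
    by have := ok h; rewrite inE hin /= => ->.
  by apply/setP=> i; rewrite inE in_setC (in_und_psi d_gt2 M_plane M_regular L_reg).
have und_inner h : (exists i, h \in und (psi L i)) <-> ~~ external (dual_root r) h.
  rewrite externalE negbK; split=> [[i]|hin].
    rewrite in_und => /orP[]/(psi_inner M_plane M_regular L_loc) //.
    by rewrite inner_opp.
  have : 0 < #|[set i | h \in und (psi L i)]| by rewrite psi_card // subn_gt0.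
  by case/card_gt0P => i; rewrite inE; exists i.
split=> [//|h|i|x].
- by rewrite externalE negbK; apply: psi_card.
- rewrite ext_forest_vertices ext_forest_roots.
  exact: psi_forest.
move=> xF x_nr; have [h def_x] : exists h, x = face h by apply: (@porbitsP _ (fcw M)).
have h_nr : face h \notin rfaces.
  by apply/root_facesPn => j; rewrite -ext_vertex_dual -def_x.
have p_ex i : exists k, k \in psi L i /\ (face k = face h /\
    forall k', k' \in psi L i -> face k' = face h -> k' = k).
  by have [k ki k_P] := psi_face L_reg i h_nr; exists k.
have [p p_P] := fin_all_exists p_ex; exists p.
have p_h i : face (p i) = face h by case: (p_P i) => _ [].
have p_orb i : p i \in porbit (fcw M) h by apply/faceP.
have lP k : k \in porbit (fcw M) h -> forall j,
    crossed j (L ((fcw M)^-1%g k)) (L k) = (k == p j).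
  move=> /faceP kh j; have [pj [_ p_uniq]] := p_P j.
  have -> : crossed j (L ((fcw M)^-1%g k)) (L k) = (k \in psi L j) by rewrite ffunE inE.
  by apply/idP/eqP => [kj|->]; [apply: p_uniq | ].
split=> [i||i k ki kx].
- apply/setP=> k; rewrite !inE; have [pi [ph p_uniq]] := p_P i.
  apply/andP/eqP => [[ki /eqP kx]|->]; last by rewrite [vert _]ph def_x.
  by apply: p_uniq => //; rewrite [LHS]kx def_x.
- split=> [i|]; first by rewrite [vert _]p_h def_x.
  by rewrite def_x; apply: (sum_findex_colored d_gt2 p_orb lP).
have ok_x : opp k \in porbit (fcw M) h by apply/faceP; rewrite -[RHS]def_x.
have := between_color d_gt2 p_orb lP (j := i) ok_x.
rewrite fcwVE oppK => /(_ (psi_in d_gt2 M_plane M_regular L_reg ki)).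
by rewrite /between /strictly_cw_between /vert [porbit _ (p _)]p_h.
Qed.

End SchnyderPsi.

(* The colors of the two opposite arcs of an edge form the intervals [s, t-1] and
   [s', t'-1]. *)
Lemma opposite_arcs d (s t s' t' : 'I_d) : s != t ->
  cdist s t + cdist s' t' = d - 2 ->
  (forall j, crossed j s t -> 2 <= cdist j s' <= cdist j t') ->
  s' = ordS t /\ s = ordS t'.
Proof.
move=> st sum_d in_st.
have n_gt0 : 0 < cdist s t by rewrite lt0n cdist_eq0.
have := in_st s; rewrite {1}/crossed cdistaa => /(_ n_gt0)/andP[a_ge2 a_b].
(* Otherwise [in_st] fails at [s'] if it is crossed, or at [t-1] if [s' = t]. *)
have a_gt : cdist s t < cdist s s'.
  rewrite ltnNge leq_eqVlt; apply/negP => /orP[/eqP/cdistK def_s'|/in_st].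
    have := in_st (ord_pred t); rewrite def_s'.
    by move: n_gt0; rewrite /crossed; cyclic_lia.
  by rewrite cdistaa.
have b_a : cdist s' t' = cdist s t' - cdist s s'.
  by move: a_b; cyclic_lia.
have a_lt := cdist_lt s s'; have b_lt := cdist_lt s t'.
split; apply: (cdistK (a := s)).
  by have := cdist_ordS_cases s t; lia.
by have := cdist_ordS_cases s t'; rewrite cdistaa; lia.
Qed.

(** * From Schnyder decompositions to regular labellings *)

Section SchnyderLabelling.
Variables (d : nat) (M : cmap) (r : dart M).
Hypotheses (d_gt2 : 2 < d) (M_plane : plane_graph M) (M_regular : regular M d).
Implicit Types (h k : dart M) (i j m : 'I_d).
Local Notation opp := (Defs.opp M).
Local Notation root := (root_vertex r).
Local Notation redge := (@root_edge d M r).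
Local Notation rface := (@root_face d M r).
Local Notation rfaces := (@root_faces d M r).

Hypothesis rface_inj : injective rface.
Variable F : {ffun 'I_d -> {set dart M}}.
Hypothesis F_sch : schnyder_decomposition (dual_root r) F.

Lemma schnyder_inner i h : h \in F i -> inner r h.
Proof.
case: F_sch => F_ext _ _ _ hi; rewrite -[inner r h]negbK -externalE.
by apply: (F_ext h).1; exists i; rewrite in_setU hi.
Qed.

Lemma schnyder_card h : inner r h -> #|[set i | h \in und (F i)]| = d - 2.
Proof. by case: F_sch => _ F_card _ _ hin; apply: F_card; rewrite externalE negbK. Qed.

Lemma schnyder_opp i h : h \in F i -> opp h \notin F i.
Proof. by case: F_sch => _ _ F_for _; case: (F_for i) => F_opp _ _ _ _; apply: F_opp. Qed.

Lemma schnyder_head i h : h \in F i -> face (opp h) \in forest_vertices r i.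
Proof.
case: F_sch => _ _ F_for _; have := F_for i; rewrite ext_forest_vertices.
by case=> _ F_S _ _ _ /F_S[].
Qed.

Lemma schnyder_nonroot i h : h \in F i -> face h \notin rfaces.
Proof.
case: F_sch => _ _ F_for _; have := F_for i.
rewrite ext_forest_vertices ext_forest_roots => F_i hi.
have /negP h_R := root_no_out F_i hi; case: F_i => _ /(_ _ hi)[h_S _] _ _ _.
apply/root_facesP => -[m hm]; case: h_R; rewrite [vert _]hm; apply/imsetP.
exists m => //; rewrite inE; move: h_S; rewrite [vert _]hm !inE => /andP[/norP[h1 h2] _].
by apply/andP; split; [apply: contraNneq h1 | apply: contraNneq h2] => ->.
Qed.

Lemma schnyder_out h : face h \notin rfaces -> exists p : 'I_d -> dart M,
  [/\ forall i k, face k = face h -> (k \in F i) = (k == p i),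
      forall i, face (p i) = face h,
      \sum_i findex (fcw M) (p i) (p (ordS i)) = #|face h|
    & forall i k, k \in F i -> face (opp k) = face h ->
        @strictly_cw_between (dual M) (p (ordS i)) (opp k) (p (ord_pred i))].
Proof.
move=> h_nr; case: F_sch => _ _ _ F_out.
have [|j|p [p_F [p_h p_sum] p_in]] := F_out (face h); first exact: porbit_mem.
  by rewrite ext_vertex_dual; apply: (elimT (root_facesPn _ _ _) h_nr).
exists p; split=> // i k kh.
have kh' : @vert (dual M) k = face h := kh.
by have /setP/(_ k) := p_F i; rewrite !inE kh' eqxx andbT.
Qed.

(** Non-root faces are colored one by one with [orbit_coloring], and root-faces constantly, which is
    consistent because they are distinct. *)
Lemma schnyder_coloring : exists L : {ffun dart M -> 'I_d},
  (forall i h, (h \in F i) = crossed i (L ((fcw M)^-1%g h)) (L h)) /\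
  (forall m h, h \in rface m -> L h = m).
Proof.
have l_ex (f : {set dart M}) : exists l : dart M -> 'I_d,
    (forall h, f = face h -> f \notin rfaces ->
      forall i, crossed i (l ((fcw M)^-1%g h)) (l h) = (h \in F i)) /\
    (forall m, f = rface m -> forall h, l h = m).
  case: (boolP (f \in rfaces)) => [/root_facesP[m def_f]|f_nr].
    by exists (fun=> m); split=> // m'; rewrite def_f => /rface_inj.
  have f_nm m : f = rface m -> False by move=> fm; case/root_facesP: f_nr; exists m.
  case: (boolP (f \in faces M)) => [/porbitsP[h def_f]|fF]; last first.
    exists (fun=> Ordinal (ltnW (ltnW d_gt2))); split=> [h def_f|m /f_nm //].
    by rewrite def_f porbit_mem in fF.
  have h_nr : face h \notin rfaces by rewrite -[face h]def_f.
  have [p [p_F p_h p_sum _]] := schnyder_out h_nr.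
  have p_orb i : p i \in porbit (fcw M) h by apply/faceP.
  have [l l_P] := orbit_coloring p_orb p_sum.
  exists l; split=> [k def_f' _ i|m /f_nm //].
  have kh : face k = face h by rewrite -def_f' def_f.
  by rewrite p_F // l_P //; apply/faceP.
have [l l_P] := fin_all_exists l_ex.
exists [ffun h => l (face h) h]; split=> [i h|m h /faceP hm]; last first.
  by rewrite ffunE; have [_] := l_P (face h); apply.
rewrite !ffunE [face ((fcw M)^-1%g h)]porbit_stepV -/(face h).
have [l_F l_r] := l_P (face h); case: (boolP (face h \in rfaces)) => [h_r|h_nr].
  have /root_facesP[m hm] := h_r; rewrite !(l_r m) // crossedaa.
  by apply/negP => /schnyder_nonroot; rewrite h_r.
by rewrite l_F.
Qed.

Section Coloring.
Variable L : {ffun dart M -> 'I_d}.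
Hypothesis L_F : forall i h, (h \in F i) = crossed i (L ((fcw M)^-1%g h)) (L h).
Hypothesis L_root : forall m h, h \in rface m -> L h = m.

Lemma schnyder_crossed h : cdist (L ((fcw M)^-1%g h)) (L h) = #|[set i | h \in F i]|.
Proof. by rewrite -card_crossed; apply: eq_card => i; rewrite !inE L_F. Qed.

(** At a non-root face this is condition (iii), read through [color_of_between]; at a root-face the
    color is constant, and neither [i] nor [i+1]. *)
Lemma schnyder_in i h : h \in F i -> 2 <= cdist i (L (cw M h)) <= cdist i (L (opp h)).
Proof.
move=> hi; case: (boolP (face (opp h) \in rfaces)) => [/root_facesP[m hm]|h_nr].
  have cw_m : cw M h \in rface m by rewrite -hm -face_cw porbit_id.
  have opp_m : opp h \in rface m by rewrite -hm porbit_id.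
  rewrite (L_root cw_m) (L_root opp_m) leqnn andbT.
  have := schnyder_head hi; rewrite hm !inE => /andP[/norP[h1 h2] _].
  have m1 : m != i by apply: contraNneq h1 => ->.
  have m2 : m != ordS i by apply: contraNneq h2 => ->.
  by move: m1 m2; rewrite -!(inj_eq (@ord_inj d)); cyclic_lia.
have [p [p_F p_h _ p_in]] := schnyder_out h_nr.
have p_orb j : p j \in porbit (fcw M) (opp h) by apply/faceP.
have lP k : k \in porbit (fcw M) (opp h) -> forall j,
    crossed j (L ((fcw M)^-1%g k)) (L k) = (k == p j).
  by move=> /faceP kh j; rewrite -L_F p_F.
have := color_of_between d_gt2 p_orb lP (j := i) (porbit_id _ _).
rewrite [(fcw M)^-1%g (opp h)]fcwVE oppK; apply; last first.
  have := p_in i h hi (erefl _).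
  by rewrite /between /strictly_cw_between /vert [porbit _ (p _)]p_h.
(* The increment at an arc is the number of its colors, at most [d-2] since its edge is in [d-2]
   forests. *)
have pF : p (ordS i) \in F (ordS i) by rewrite p_F.
rewrite schnyder_crossed -(schnyder_card (schnyder_inner pF)).
by apply: subset_leq_card; apply/subsetP=> j; rewrite !inE => ->.
Qed.

(** The increments on both sides of an edge count the colors of its two arcs, hence add up to [d-2],
    and [opposite_arcs] applies. *)
Lemma schnyder_cw h : inner r h -> L (cw M h) = ordS (L h).
Proof.
move=> hin; have hin' : inner r (opp h) by rewrite inner_opp.
have sum_d : cdist (L (cw M (opp h))) (L h) + cdist (L (cw M h)) (L (opp h)) = d - 2.
  rewrite -(schnyder_card hin) -fcwVE schnyder_crossed.
  have := schnyder_crossed (opp h); rewrite fcwVE oppK => ->.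
  have -> : [set i | h \in und (F i)] = [set i | h \in F i] :|: [set i | opp h \in F i].
    by apply/setP=> i; rewrite in_setU [LHS]in_set in_und !inE.
  rewrite cardsU (_ : _ :&: _ = set0) ?cards0 ?subn0 //.
  by apply/setP=> i; rewrite !inE; apply/andP => -[/schnyder_opp/negP].
have in1 j : crossed j (L (cw M (opp h))) (L h) ->
    2 <= cdist j (L (cw M h)) <= cdist j (L (opp h)).
  by rewrite -fcwVE -L_F; apply: schnyder_in.
have in2 j : crossed j (L (cw M h)) (L (opp h)) ->
    2 <= cdist j (L (cw M (opp h))) <= cdist j (L h).
  by rewrite -{1}[h]oppK -fcwVE -L_F => /schnyder_in; rewrite oppK.
(* As [d-2] is positive, one of the two arcs has a color; it plays the first role in
   [opposite_arcs]. *)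
case: (eqVneq (L (cw M (opp h))) (L h)) => [eq_L|neq_L].
  have neq' : L (cw M h) != L (opp h).
    rewrite -cdist_eq0; move: sum_d; rewrite eq_L cdistaa; lia.
  by rewrite addnC in sum_d; case: (opposite_arcs neq' sum_d in2).
by case: (opposite_arcs neq_L sum_d in1).
Qed.

Lemma schnyder_regular : regular_labelling r L.
Proof.
have L_redge i : L (redge i) = ordS i.
  by apply: L_root; apply: mem_root_face.
split=> // [h hr|h|f fF f_nr].
- elim/(inner_ind M_regular (r := r)): h hr => [h /schnyder_cw //|i|i _].
    by rewrite vert_root_edge eqxx.
  rewrite (L_root (mem_root_face_opp r i)); apply: L_root.
  by apply/faceP; rewrite face_cw oppK; apply/faceP; apply: mem_root_face.
- case/(root_edgeP M_regular) => i ->; rewrite L_redge ordSK; apply: L_root.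
  exact: porbit_id.
have [h def_f] := porbitsP fF; rewrite def_f.
(* There are as many descents as outgoing arcs of any given color, here the first one. *)
rewrite -(card_orbit_crossed _ _ _ (Ordinal (ltnW (ltnW d_gt2)))).
have h_nr : face h \notin rfaces by apply/root_facesPn; rewrite -[face h]def_f.
have [p [p_F p_h _ _]] := schnyder_out h_nr.
apply/eqP/cards1P; exists (p (Ordinal (ltnW (ltnW d_gt2)))); apply/setP=> k.
rewrite !inE -L_F; apply/andP/eqP => [[/faceP kh]|->]; first by rewrite p_F // => /eqP.
by rewrite p_F // eqxx; split=> //; apply/faceP.
Qed.

Lemma psi_schnyder_labelling : psi L = F.
Proof. by apply/ffunP=> i; apply/setP=> h; rewrite ffunE inE L_F. Qed.

End Coloring.

Lemma psi_surj : exists2 L, regular_labelling r L & psi L = F.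
Proof.
have [L [L_F L_root]] := schnyder_coloring.
by exists L; [apply: schnyder_regular | apply: psi_schnyder_labelling].
Qed.

End SchnyderLabelling.

(** * The two bijections *)

Theorem theorem4p3 (d : nat) (M : cmap) (r : dart M)
    (d_ge3 : 3 <= d) (M_plane : plane_graph M) (M_regular : regular M d) :
  set_bij (@regular_labelling d M r) (@regular_decomposition d M r)
          (@xi d M r) /\
  (injective (@ext_vertex d (dual M) (dual_root r)) ->
   set_bij (@schnyder_decomposition d (dual M) (dual_root r))
           (@regular_decomposition d M r)
           (@chi d M r)).
Proof.
split=> [|ext_inj].
  split=> [L|L1 L2 /classical_sets.set_mem reg1 /classical_sets.set_mem reg2|T T_dec].
  - exact: xi_regular_decomposition.
  - exact: xi_inj.
  by have [L L_reg <-] := xi_surj d_ge3 M_plane M_regular T_dec; exists L.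
have rface_inj : injective (@root_face d M r).
  by move=> i j; rewrite -!ext_vertex_dual => /ext_inj.
(* As every Schnyder decomposition is some [psi L], the claims on [chi] reduce to those on [xi] by
   [chi_psi]. *)
have surj F (F_sch : schnyder_decomposition (dual_root r) F) :=
  psi_surj d_ge3 M_regular rface_inj F_sch.
split=> [F /surj[L L_reg <-]|F1 F2|T T_dec].
- by rewrite (chi_psi d_ge3 M_plane M_regular L_reg); apply: xi_regular_decomposition.
- move=> /classical_sets.set_mem/surj[L1 reg1 <-] /classical_sets.set_mem/surj[L2 reg2 <-].
  rewrite !(chi_psi d_ge3 M_plane M_regular) // => /(xi_inj M_regular reg1 reg2) ->.
  by [].
have [L L_reg <-] := xi_surj d_ge3 M_plane M_regular T_dec; exists (psi L).
  exact: psi_schnyder.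
exact: chi_psi.
Qed.
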